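(* Let $0<q<1$ and let $$G=\begin{pmatrix} q^2R & 0 & qa & q^2b \\ 0 & q^2R & q\,b^* & -q^3a^* \\ {q}\,a^* & q\,b & 1-R & 0 \\ {q}^2b^* & -q^3a & 0 & 1-q^4R \end{pmatrix}\in M_4(\Sigma^4_q),$$ which satisfies $G^2=G$. Then $G$ defines non trivial cyclic homology classes $ch^\lambda_n(G)\in H^\lambda_{2n}(\Sigma^4_q)$ (that is, $ch_n^\lambda(G)\neq0$ for every integer $n\ge0$). The Chern--Connes pairing of $G$ with the cyclic $0$-cocycle $\mathrm{tr}_\sigma$ is $$\langle\mathrm{tr}_\sigma,G\rangle=-1 .$$
   Context: $\mathbb S^7_q$ is the unital complex $*$-algebra generated by $z_1,\dots,z_4$ with relations $z_iz_j=qz_jz_i$ ($i<j$), $z_j^*z_i=qz_iz_j^*$ ($i\ne j$), $z_k^*z_k=z_kz_k^*+(1-q^2)\sum_{j<k}z_jz_j^*$, $\sum_{k=1}^4z_kz_k^*=1$. The quantum 4-sphere $\Sigma^4_q$ is the unital $*$-subalgebra of $\mathbb S^7_q$ generated by $a=z_1z_4^*-z_2z_3^*$, $b=z_1z_3+q^{-1}z_2z_4$, $R=z_1z_1^*+z_2z_2^*$ (equivalently, the algebra of coinvariants of $\mathbb S^7_q$ under the quantum coisotropic subgroup $SU_q(2)$ of $U_q(4)$). The generators satisfy $Ra=q^{-2}aR$, $Rb=q^2bR$, $ab=q^3ba$, $ab^*=q^{-1}b^*a$, $aa^*+q^2bb^*=R(1-q^2R)$, $aa^*=q^2a^*a+(1-q^2)R^2$,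 $b^*b=q^4bb^*+(1-q^2)R$. $\Sigma^4_q$ has a one-dimensional unital $*$-representation $\epsilon$ with $\epsilon(R)=\epsilon(a)=\epsilon(b)=0$, and a unital $*$-representation $\sigma$ on $\ell^2(\mathbb N)^{\otimes2}$ with orthonormal basis $|n_1,n_2\rangle$, $n_1,n_2\ge0$: $\sigma(R)|n_1,n_2\rangle=q^{2(n_1+n_2)}|n_1,n_2\rangle$, $\sigma(a)|n_1,n_2\rangle=q^{n_1+2n_2-1}(1-q^{2n_1})^{1/2}|n_1-1,n_2\rangle$, $\sigma(b)|n_1,n_2\rangle=q^{n_1+n_2}(1-q^{2(n_2+1)})^{1/2}|n_1,n_2+1\rangle$. For every $x\in\Sigma_q^4$ the operator $\sigma(x)-\epsilon(x)1$ is trace class, and $\mathrm{tr}_\sigma(x)=\mathrm{tr}(\sigma(x)-\epsilon(x)1)$; this is a cyclic $0$-cocycle (a trace) on $\Sigma^4_q$. Cyclic homology: for an associative $\mathbb C$-algebra $A$ let $d_i(a_0\otimes\cdots\otimes a_n)=a_0\otimes\cdots\otimes a_ia_{i+1}\otimes\cdots\otimes a_n$ for $0\le i\le n-1$, $d_n(a_0\otimes\cdots\otimes a_n)=a_na_0\otimes a_1\otimes\cdots\otimes a_{n-1}$, and $\beta=\sum_{i=0}^n(-1)^id_i$. Let $t(a_0\otimes\cdots\otimes a_n)=(-1)^na_1\otimes\cdots\otimes a_n\otimes a_0$ and $C^\lambda_n(A)=A^{\otimes n+1}/(1-t)A^{\otimes n+1}$. $H^\lambda_*(A)$ is the homology of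 the Connes complex $(C^\lambda_*(A),\beta)$. The generalized trace $\mathrm{Tr}:M_k(A)^{\otimes n}\to A^{\otimes n}$ is $\mathrm{Tr}[M_1\otimes\cdots\otimes M_n]=\sum_{j_1,\dots,j_n}[M_1]_{j_1j_2}\otimes[M_2]_{j_2j_3}\otimes\cdots\otimes[M_n]_{j_nj_1}$. For an idempotent $G\in M_k(A)$, $ch^\lambda_n(G)\in H^\lambda_{2n}(A)$ is the class of $\mathrm{Tr}[(-1)^nG^{\otimes2n+1}]$. The pairing of an idempotent $G$ with a cyclic $0$-cocycle $\varphi$ is $\langle\varphi,G\rangle=\varphi(ch_0^\lambda(G))=\varphi(\mathrm{Tr}\,G)$. *)

(* Defs.v *)
From HB Require Import structures.
From mathcomp Require Import all_boot all_order all_algebra.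
From mathcomp Require Import ring_quotient.
From mathcomp Require Import all_classical all_reals all_analysis.
From mathcomp Require Import complex.
From mathcomp Require Import ring lra.

Set Implicit Arguments.
Unset Strict Implicit.
Unset Printing Implicit Defensive.

Import Order.TTheory GRing.Theory Num.Theory.

Local Open Scope ring_scope.
Local Open Scope quotient_scope.

(* [S7 C q] is the universal unital *-algebra over [C] on z_1, ..., z_4 subject
   to the relations of the quantum 7-sphere: *-algebra expressions modulo the
   smallest congruence containing the *-algebra axioms and those relations.
   The generator z_(k+1) is [sgen k], k : 'I_4; the last four constructors of
   [seqv] are the sphere relations. The parameter q is meant to be real. *)

Section QuantumSphere7.
Variables (C : numClosedFieldType) (q : C).

Inductive sterm : Type :=
| SGen of 'I_4
| SZero
| SOne
| SAdd of sterm & sterm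
| SMul of sterm & sterm
| SScale of C & sterm
| SStar of sterm.

HB.instance Definition _ := gen_eqMixin sterm.
HB.instance Definition _ := gen_choiceMixin sterm.

Definition ssum (s : seq sterm) : sterm := foldr SAdd SZero s.

Inductive seqv : sterm -> sterm -> Prop :=
| seqv_refl x : seqv x x
| seqv_sym x y : seqv x y -> seqv y x
| seqv_trans x y w : seqv x y -> seqv y w -> seqv x w
| seqv_add x x' y y' : seqv x x' -> seqv y y' -> seqv (SAdd x y) (SAdd x' y')
| seqv_mul x x' y y' : seqv x x' -> seqv y y' -> seqv (SMul x y) (SMul x' y')
| seqv_scale c x x' : seqv x x' -> seqv (SScale c x) (SScale c x')
| seqv_star x x' : seqv x x' -> seqv (SStar x) (SStar x')
| seqv_addA x y w : seqv (SAdd x (SAdd y w)) (SAdd (SAdd x y) w)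
| seqv_addC x y : seqv (SAdd x y) (SAdd y x)
| seqv_add0 x : seqv (SAdd SZero x) x
| seqv_addN x : seqv (SAdd (SScale (-1) x) x) SZero
| seqv_scaleA c d x : seqv (SScale c (SScale d x)) (SScale (c * d) x)
| seqv_scale1 x : seqv (SScale 1 x) x
| seqv_scaleDr c x y :
    seqv (SScale c (SAdd x y)) (SAdd (SScale c x) (SScale c y))
| seqv_scaleDl c d x :
    seqv (SScale (c + d) x) (SAdd (SScale c x) (SScale d x))
| seqv_mulA x y w : seqv (SMul x (SMul y w)) (SMul (SMul x y) w)
| seqv_mul1l x : seqv (SMul SOne x) x
| seqv_mul1r x : seqv (SMul x SOne) x
| seqv_mulDl x y w : seqv (SMul (SAdd x y) w) (SAdd (SMul x w) (SMul y w))
| seqv_mulDr x y w : seqv (SMul x (SAdd y w)) (SAdd (SMul x y) (SMul x w))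
| seqv_scaleAl c x y : seqv (SScale c (SMul x y)) (SMul (SScale c x) y)
| seqv_scaleAr c x y : seqv (SScale c (SMul x y)) (SMul x (SScale c y))
| seqv_starK x : seqv (SStar (SStar x)) x
| seqv_starD x y : seqv (SStar (SAdd x y)) (SAdd (SStar x) (SStar y))
| seqv_starM x y : seqv (SStar (SMul x y)) (SMul (SStar y) (SStar x))
| seqv_starZ c x : seqv (SStar (SScale c x)) (SScale c^* (SStar x))
| seqv_zz (i j : 'I_4) : (i < j)%N ->
    seqv (SMul (SGen i) (SGen j)) (SScale q (SMul (SGen j) (SGen i)))
| seqv_zsz (i j : 'I_4) : i != j ->
    seqv (SMul (SStar (SGen j)) (SGen i))
         (SScale q (SMul (SGen i) (SStar (SGen j))))
| seqv_zszk (k : 'I_4) :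
    seqv (SMul (SStar (SGen k)) (SGen k))
         (SAdd (SMul (SGen k) (SStar (SGen k)))
               (SScale (1 - q ^+ 2)
                  (ssum [seq SMul (SGen j) (SStar (SGen j))
                        | j : 'I_4 <- enum 'I_4 & (j < k)%N])))
| seqv_sphere :
    seqv (ssum [seq SMul (SGen k) (SStar (SGen k)) | k <- enum 'I_4]) SOne.

Definition seqvb : rel sterm := fun x y => `[< seqv x y >].

Lemma seqvb_equiv : equiv_class_of seqvb.
Proof.
split=> [x|x y|y x w]; first exact/asboolP/seqv_refl.
- by apply/idP/idP => /asboolP h; apply/asboolP/seqv_sym.
- by move=> /asboolP h1 /asboolP h2; apply/asboolP/(seqv_trans h1 h2).
Qed.

Canonical seqv_equiv := EquivRelPack seqvb_equiv.
Canonical seqv_encModRel := defaultEncModRel seqvb.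

Definition S7 : Type := {eq_quot seqvb}.
HB.instance Definition _ : EqQuotient sterm seqvb S7 := EqQuotient.on S7.
HB.instance Definition _ := Choice.on S7.

Local Notation pi := (\pi_S7).

Lemma S7_piP x y : pi x = pi y <-> seqv x y.
Proof.
split=> [/eqP|h]; first by rewrite piE => /asboolP.
by apply/eqP; rewrite piE; apply/asboolP.
Qed.

Lemma seqv_repr x : seqv (repr (pi x)) x.
Proof. by apply/S7_piP; rewrite reprK. Qed.

Definition sadd (x y : S7) : S7 := pi (SAdd (repr x) (repr y)).
Definition sopp (x : S7) : S7 := pi (SScale (-1) (repr x)).
Definition smul (x y : S7) : S7 := pi (SMul (repr x) (repr y)).
Definition sscale (c : C) (x : S7) : S7 := pi (SScale c (repr x)).
Definition sstar (x : S7) : S7 := pi (SStar (repr x)).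
Definition sgen (k : 'I_4) : S7 := pi (SGen k).

Lemma sadd_pi x y : sadd (pi x) (pi y) = pi (SAdd x y).
Proof. by apply/S7_piP/seqv_add; exact: seqv_repr. Qed.
Lemma sopp_pi x : sopp (pi x) = pi (SScale (-1) x).
Proof. by apply/S7_piP/seqv_scale/seqv_repr. Qed.
Lemma smul_pi x y : smul (pi x) (pi y) = pi (SMul x y).
Proof. by apply/S7_piP/seqv_mul; exact: seqv_repr. Qed.
Lemma sscale_pi c x : sscale c (pi x) = pi (SScale c x).
Proof. by apply/S7_piP/seqv_scale/seqv_repr. Qed.
Lemma sstar_pi x : sstar (pi x) = pi (SStar x).
Proof. by apply/S7_piP/seqv_star/seqv_repr. Qed.

Definition spiE := (sadd_pi, sopp_pi, smul_pi, sscale_pi, sstar_pi).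

Lemma S7_ind (P : S7 -> Prop) : (forall x, P (pi x)) -> forall x, P x.
Proof. by move=> h x; rewrite -[x]reprK. Qed.

Fact saddA : associative sadd.
Proof.
elim/S7_ind=> x; elim/S7_ind=> y; elim/S7_ind=> w.
by rewrite !spiE; apply/S7_piP/seqv_addA.
Qed.
Fact saddC : commutative sadd.
Proof.
by elim/S7_ind=> x; elim/S7_ind=> y; rewrite !spiE; apply/S7_piP/seqv_addC.
Qed.
Fact sadd0 : left_id (pi SZero) sadd.
Proof. by elim/S7_ind=> x; rewrite !spiE; apply/S7_piP/seqv_add0. Qed.
Fact saddN : left_inverse (pi SZero) sopp sadd.
Proof. by elim/S7_ind=> x; rewrite !spiE; apply/S7_piP/seqv_addN. Qed.

HB.instance Definition _ := GRing.isZmodule.Build S7 saddA saddC sadd0 saddN.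

(* The character z_4 |-> 1, z_1, z_2, z_3 |-> 0; it shows that 1 != 0. *)
Fixpoint seval (x : sterm) : C :=
  match x with
  | SGen k => (k == 3 :> nat)%:R
  | SZero => 0
  | SOne => 1
  | SAdd x y => seval x + seval y
  | SMul x y => seval x * seval y
  | SScale c x => c * seval x
  | SStar x => (seval x)^*
  end.

Lemma seval_ssum s : seval (ssum s) = \sum_(x <- s) seval x.
Proof. by elim: s => [|x s IHs]; rewrite ?big_nil ?big_cons //= IHs. Qed.

Lemma seval_seqv x y : seqv x y -> seval x = seval y.
Proof.
elim=> /=.
- by [].
- by [].
- by move=> ? ? ? _ -> _ ->.
- by move=> ? ? ? ? _ -> _ ->.
- by move=> ? ? ? ? _ -> _ ->.
- by move=> ? ? ? _ ->.
- by move=> ? ? _ ->.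
- by move=> *; rewrite addrA.
- by move=> *; rewrite addrC.
- by move=> *; rewrite add0r.
- by move=> *; rewrite mulN1r addNr.
- by move=> *; rewrite mulrA.
- by move=> *; rewrite mul1r.
- by move=> *; rewrite mulrDr.
- by move=> *; rewrite mulrDl.
- by move=> *; rewrite mulrA.
- by move=> *; rewrite mul1r.
- by move=> *; rewrite mulr1.
- by move=> *; rewrite mulrDl.
- by move=> *; rewrite mulrDr.
- by move=> *; rewrite mulrA.
- by move=> *; rewrite mulrCA.
- by move=> *; rewrite conjCK.
- by move=> *; rewrite rmorphD.
- by move=> *; rewrite rmorphM mulrC.
- by move=> *; rewrite rmorphM.
- move=> i j ij.
  have -> : (i == 3 :> nat) = false.
    by apply/ltn_eqF/(leq_trans ij); rewrite -ltnS.
  by rewrite !(mul0r, mulr0).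
- move=> i j ij; rewrite conjC_nat.
  case: (eqVneq (i : nat) 3) => [i3|_]; last by rewrite !(mul0r, mulr0).
  have -> : (j == 3 :> nat) = false.
    by apply/negbTE; apply: contraNneq ij => j3; rewrite -val_eqE /= i3 j3.
  by rewrite !(mul0r, mulr0).
- move=> k; rewrite seval_ssum big_map big_filter big1 ?mulr0 ?addr0.
    by rewrite mulrC.
  move=> j jk /=; have -> : (j == 3 :> nat) = false; last by rewrite mul0r.
  by apply/ltn_eqF/(leq_trans jk); rewrite -ltnS.
- rewrite seval_ssum big_map big_enum /= (bigD1 ord_max) //= conjC1 mulr1.
  rewrite big1 ?addr0 // => j /negbTE; rewrite -val_eqE /= => ->.
  by rewrite mul0r.
Qed.

Fact smulA : associative smul.
Proof.
elim/S7_ind=> x; elim/S7_ind=> y; elim/S7_ind=> w.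
by rewrite !spiE; apply/S7_piP/seqv_mulA.
Qed.
Fact smul1l : left_id (pi SOne) smul.
Proof. by elim/S7_ind=> x; rewrite !spiE; apply/S7_piP/seqv_mul1l. Qed.
Fact smul1r : right_id (pi SOne) smul.
Proof. by elim/S7_ind=> x; rewrite !spiE; apply/S7_piP/seqv_mul1r. Qed.
Fact smulDl : left_distributive smul sadd.
Proof.
elim/S7_ind=> x; elim/S7_ind=> y; elim/S7_ind=> w.
by rewrite !spiE; apply/S7_piP/seqv_mulDl.
Qed.
Fact smulDr : right_distributive smul sadd.
Proof.
elim/S7_ind=> x; elim/S7_ind=> y; elim/S7_ind=> w.
by rewrite !spiE; apply/S7_piP/seqv_mulDr.
Qed.
Fact sone_neq0 : pi SOne != pi SZero.
Proof.
by apply/eqP => /S7_piP /seval_seqv /= /eqP; rewrite oner_eq0.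
Qed.

HB.instance Definition _ := GRing.Zmodule_isNzRing.Build S7
  smulA smul1l smul1r smulDl smulDr sone_neq0.

Fact sscaleA c d x : sscale c (sscale d x) = sscale (c * d) x.
Proof. by elim/S7_ind: x => x; rewrite !spiE; apply/S7_piP/seqv_scaleA. Qed.
Fact sscale1 : left_id 1 sscale.
Proof. by elim/S7_ind=> x; rewrite !spiE; apply/S7_piP/seqv_scale1. Qed.
Fact sscaleDr : right_distributive sscale sadd.
Proof.
move=> c; elim/S7_ind=> x; elim/S7_ind=> y.
by rewrite !spiE; apply/S7_piP/seqv_scaleDr.
Qed.
Fact sscaleDl x c d : sscale (c + d) x = sadd (sscale c x) (sscale d x).
Proof. by elim/S7_ind: x => x; rewrite !spiE; apply/S7_piP/seqv_scaleDl. Qed.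

HB.instance Definition _ := GRing.Zmodule_isLmodule.Build C S7
  sscaleA sscale1 sscaleDr sscaleDl.

Fact sscaleAl c (x y : S7) : sscale c (smul x y) = smul (sscale c x) y.
Proof.
elim/S7_ind: x => x; elim/S7_ind: y => y.
by rewrite !spiE; apply/S7_piP/seqv_scaleAl.
Qed.
HB.instance Definition _ := GRing.Lmodule_isLalgebra.Build C S7 sscaleAl.

Fact sscaleAr c (x y : S7) : sscale c (smul x y) = smul x (sscale c y).
Proof.
elim/S7_ind: x => x; elim/S7_ind: y => y.
by rewrite !spiE; apply/S7_piP/seqv_scaleAr.
Qed.
HB.instance Definition _ := GRing.Lalgebra_isAlgebra.Build C S7 sscaleAr.

Definition z1 : S7 := sgen (@Ordinal 4 0 isT).
Definition z2 : S7 := sgen (@Ordinal 4 1 isT).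
Definition z3 : S7 := sgen (@Ordinal 4 2 isT).
Definition z4 : S7 := sgen (@Ordinal 4 3 isT).

Definition S7a : S7 := z1 * sstar z4 - z2 * sstar z3.
Definition S7b : S7 := z1 * z3 + q^-1 *: (z2 * z4).
Definition S7R : S7 := z1 * sstar z1 + z2 * sstar z2.

Definition star_subalgebra (P : S7 -> Prop) : Prop :=
  [/\ P 1, forall c x y, P x -> P y -> P (c *: x + y),
      forall x y, P x -> P y -> P (x * y) & forall x, P x -> P (sstar x)].

(* Membership in the smallest unital *-subalgebra containing a, b and R. *)
Definition in_Sigma4 : pred S7 := fun x =>
  `[< forall P : S7 -> Prop,
        star_subalgebra P -> P S7a -> P S7b -> P S7R -> P x >].

Fact in_Sigma4_subalg : GRing.subalg_closed in_Sigma4.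
Proof.
split.
- by apply/asboolP => P [].
- move=> c x y /asboolP xS /asboolP yS; apply/asboolP => P PS Pa Pb PR.
  by case: (PS) => _ + _ _; apply; [exact: xS|exact: yS].
- move=> x y /asboolP xS /asboolP yS; apply/asboolP => P PS Pa Pb PR.
  by case: (PS) => _ _ + _; apply; [exact: xS|exact: yS].
Qed.
HB.instance Definition _ := GRing.isSubalgClosed.Build C S7 in_Sigma4
  (GRing.subalg_closed_semi in_Sigma4_subalg).

Fact in_Sigma4_star x : in_Sigma4 x -> in_Sigma4 (sstar x).
Proof.
move=> /asboolP xS; apply/asboolP => P PS Pa Pb PR.
by case: (PS) => _ _ _; apply; exact: xS.
Qed.

Record Sigma4 : Type := MkSigma4 { Sigma4_val : S7; _ : in_Sigma4 Sigma4_val }.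
HB.instance Definition _ := [isSub for Sigma4_val].
HB.instance Definition _ := [Choice of Sigma4 by <:].
HB.instance Definition _ := [SubChoice_isSubAlgebra of Sigma4 by <:].

Definition Sigma4_star (x : Sigma4) : Sigma4 :=
  MkSigma4 (in_Sigma4_star (valP x)).

Fact in_Sigma4_a : in_Sigma4 S7a. Proof. exact/asboolP. Qed.
Fact in_Sigma4_b : in_Sigma4 S7b. Proof. exact/asboolP. Qed.
Fact in_Sigma4_R : in_Sigma4 S7R. Proof. exact/asboolP. Qed.
Definition ga : Sigma4 := MkSigma4 in_Sigma4_a.
Definition gb : Sigma4 := MkSigma4 in_Sigma4_b.
Definition gR : Sigma4 := MkSigma4 in_Sigma4_R.

Local Notation "x ^*s" := (Sigma4_star x) (at level 2, format "x ^*s").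

Definition Gq : 'M[Sigma4]_4 :=
  \matrix_(i, j) nth 0 (nth [::]
   [:: [:: q ^+ 2 *: gR;    0;                q *: ga;     q ^+ 2 *: gb];
       [:: 0;               q ^+ 2 *: gR;     q *: gb^*s;  - (q ^+ 3 *: ga^*s)];
       [:: q *: ga^*s;      q *: gb;          1 - gR;      0];
       [:: q ^+ 2 *: gb^*s; - (q ^+ 3 *: ga); 0;           1 - q ^+ 4 *: gR]]
   i) j.

End QuantumSphere7.
(* [tpow V n] is the tensor power of n copies of V over C: formal linear
   combinations of n-tuples of vectors modulo the smallest congruence making
   it a vector space and [pure] multilinear. *)

Section TensorPower.
Variables (C : numClosedFieldType) (V : lmodType C) (n : nat).

Inductive tterm : Type :=
| TPure of 'I_n -> V
| TZero
| TAdd of tterm & tterm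
| TScale of C & tterm.

HB.instance Definition _ := gen_eqMixin tterm.
HB.instance Definition _ := gen_choiceMixin tterm.

Inductive teqv : tterm -> tterm -> Prop :=
| teqv_refl x : teqv x x
| teqv_sym x y : teqv x y -> teqv y x
| teqv_trans x y w : teqv x y -> teqv y w -> teqv x w
| teqv_add x x' y y' : teqv x x' -> teqv y y' -> teqv (TAdd x y) (TAdd x' y')
| teqv_scale c x x' : teqv x x' -> teqv (TScale c x) (TScale c x')
| teqv_addA x y w : teqv (TAdd x (TAdd y w)) (TAdd (TAdd x y) w)
| teqv_addC x y : teqv (TAdd x y) (TAdd y x)
| teqv_add0 x : teqv (TAdd TZero x) x
| teqv_addN x : teqv (TAdd (TScale (-1) x) x) TZero
| teqv_scaleA c d x : teqv (TScale c (TScale d x)) (TScale (c * d) x)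
| teqv_scale1 x : teqv (TScale 1 x) x
| teqv_scaleDr c x y :
    teqv (TScale c (TAdd x y)) (TAdd (TScale c x) (TScale c y))
| teqv_scaleDl c d x :
    teqv (TScale (c + d) x) (TAdd (TScale c x) (TScale d x))
| teqv_pureD (i : 'I_n) (u v w : 'I_n -> V) :
    w i = u i + v i -> (forall j, j != i -> w j = u j /\ w j = v j) ->
    teqv (TPure w) (TAdd (TPure u) (TPure v))
| teqv_pureZ (i : 'I_n) (c : C) (u w : 'I_n -> V) :
    w i = c *: u i -> (forall j, j != i -> w j = u j) ->
    teqv (TPure w) (TScale c (TPure u)).

Definition teqvb : rel tterm := fun x y => `[< teqv x y >].

Lemma teqvb_equiv : equiv_class_of teqvb.
Proof.
split=> [x|x y|y x w]; first exact/asboolP/teqv_refl.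
- by apply/idP/idP => /asboolP h; apply/asboolP/teqv_sym.
- by move=> /asboolP h1 /asboolP h2; apply/asboolP/(teqv_trans h1 h2).
Qed.

Canonical teqv_equiv := EquivRelPack teqvb_equiv.
Canonical teqv_encModRel := defaultEncModRel teqvb.

Definition tpow : Type := {eq_quot teqvb}.
HB.instance Definition _ : EqQuotient tterm teqvb tpow := EqQuotient.on tpow.
HB.instance Definition _ := Choice.on tpow.

Local Notation pi := (\pi_tpow).

Lemma tpow_piP x y : pi x = pi y <-> teqv x y.
Proof.
split=> [/eqP|h]; first by rewrite piE => /asboolP.
by apply/eqP; rewrite piE; apply/asboolP.
Qed.

Lemma teqv_repr x : teqv (repr (pi x)) x.
Proof. by apply/tpow_piP; rewrite reprK. Qed.

Definition tadd (x y : tpow) : tpow := pi (TAdd (repr x) (repr y)).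
Definition topp (x : tpow) : tpow := pi (TScale (-1) (repr x)).
Definition tscale (c : C) (x : tpow) : tpow := pi (TScale c (repr x)).
Definition pure (u : 'I_n -> V) : tpow := pi (TPure u).

Lemma tadd_pi x y : tadd (pi x) (pi y) = pi (TAdd x y).
Proof. by apply/tpow_piP/teqv_add; exact: teqv_repr. Qed.
Lemma topp_pi x : topp (pi x) = pi (TScale (-1) x).
Proof. by apply/tpow_piP/teqv_scale/teqv_repr. Qed.
Lemma tscale_pi c x : tscale c (pi x) = pi (TScale c x).
Proof. by apply/tpow_piP/teqv_scale/teqv_repr. Qed.

Definition tpiE := (tadd_pi, topp_pi, tscale_pi).

Lemma tpow_repr_ind (P : tpow -> Prop) : (forall x, P (pi x)) -> forall x, P x.
Proof. by move=> h x; rewrite -[x]reprK. Qed.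

Fact taddA : associative tadd.
Proof.
elim/tpow_repr_ind=> x; elim/tpow_repr_ind=> y; elim/tpow_repr_ind=> w.
by rewrite !tpiE; apply/tpow_piP/teqv_addA.
Qed.
Fact taddC : commutative tadd.
Proof.
elim/tpow_repr_ind=> x; elim/tpow_repr_ind=> y.
by rewrite !tpiE; apply/tpow_piP/teqv_addC.
Qed.
Fact tadd0 : left_id (pi TZero) tadd.
Proof.
by elim/tpow_repr_ind=> x; rewrite !tpiE; apply/tpow_piP/teqv_add0.
Qed.
Fact taddN : left_inverse (pi TZero) topp tadd.
Proof.
by elim/tpow_repr_ind=> x; rewrite !tpiE; apply/tpow_piP/teqv_addN.
Qed.

HB.instance Definition _ := GRing.isZmodule.Build tpow taddA taddC tadd0 taddN.

Fact tscaleA c d x : tscale c (tscale d x) = tscale (c * d) x.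
Proof.
by elim/tpow_repr_ind: x => x; rewrite !tpiE; apply/tpow_piP/teqv_scaleA.
Qed.
Fact tscale1 : left_id 1 tscale.
Proof.
by elim/tpow_repr_ind=> x; rewrite !tpiE; apply/tpow_piP/teqv_scale1.
Qed.
Fact tscaleDr : right_distributive tscale tadd.
Proof.
move=> c; elim/tpow_repr_ind=> x; elim/tpow_repr_ind=> y.
by rewrite !tpiE; apply/tpow_piP/teqv_scaleDr.
Qed.
Fact tscaleDl x c d : tscale (c + d) x = tadd (tscale c x) (tscale d x).
Proof.
by elim/tpow_repr_ind: x => x; rewrite !tpiE; apply/tpow_piP/teqv_scaleDl.
Qed.

HB.instance Definition _ := GRing.Zmodule_isLmodule.Build C tpow
  tscaleA tscale1 tscaleDr tscaleDl.

Lemma tpi_zero : pi TZero = 0. Proof. by []. Qed.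
Lemma tpi_add x y : pi (TAdd x y) = pi x + pi y.
Proof. by rewrite -tadd_pi. Qed.
Lemma tpi_scale c x : pi (TScale c x) = c *: pi x.
Proof. by rewrite -tscale_pi. Qed.

Lemma tpow_ind (P : tpow -> Prop) :
  (forall u, P (pure u)) -> P 0 -> (forall x y, P x -> P y -> P (x + y)) ->
  (forall c x, P x -> P (c *: x)) -> forall x, P x.
Proof.
move=> hp h0 hD hZ; elim/tpow_repr_ind; elim => [u||x ihx y ihy|c x ihx].
- exact: hp.
- exact: h0.
- by rewrite tpi_add; apply: hD.
- by rewrite tpi_scale; apply: hZ.
Qed.

Definition multilinear (W : lmodType C) (f : ('I_n -> V) -> W) : Prop :=
  (forall i u v w, w i = u i + v i ->
     (forall j, j != i -> w j = u j /\ w j = v j) -> f w = f u + f v) /\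
  (forall i c u w, w i = c *: u i -> (forall j, j != i -> w j = u j) ->
     f w = c *: f u).

Lemma pure_multilinear : multilinear pure.
Proof.
split=> [i u v w wi wj|i c u w wi wj].
- by rewrite -tpi_add; apply/tpow_piP/(teqv_pureD wi wj).
- by rewrite -tpi_scale; apply/tpow_piP/(teqv_pureZ wi wj).
Qed.

(* The linear map induced by a multilinear map f. *)
Section Lift.
Variables (W : lmodType C) (f : ('I_n -> V) -> W).

Fixpoint teval (x : tterm) : W :=
  match x with
  | TPure u => f u
  | TZero => 0
  | TAdd x y => teval x + teval y
  | TScale c x => c *: teval x
  end.

Definition tlift (x : tpow) : W := teval (repr x).

Hypothesis fM : multilinear f.

Lemma teval_teqv x y : teqv x y -> teval x = teval y.
Proof.
elim=> /=.
- by [].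
- by [].
- by move=> ? ? ? _ -> _ ->.
- by move=> ? ? ? ? _ -> _ ->.
- by move=> ? ? ? _ ->.
- by move=> *; rewrite addrA.
- by move=> *; rewrite addrC.
- by move=> *; rewrite add0r.
- by move=> *; rewrite scaleN1r addNr.
- by move=> *; rewrite scalerA.
- by move=> *; rewrite scale1r.
- by move=> *; rewrite scalerDr.
- by move=> *; rewrite scalerDl.
- by case: fM => h _ i u v w; apply: h.
- by case: fM => _ h i c u w; apply: h.
Qed.

Lemma tlift_pi x : tlift (pi x) = teval x.
Proof. by apply/teval_teqv/teqv_repr. Qed.

Lemma tlift_pure u : tlift (pure u) = f u.
Proof. exact: tlift_pi. Qed.

Lemma tlift_linear : linear tlift.
Proof.
move=> c; elim/tpow_repr_ind=> x; elim/tpow_repr_ind=> y.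
by rewrite -tpi_scale -tpi_add !tlift_pi.
Qed.

End Lift.

End TensorPower.
Section CyclicHomology.
Variables (C : numClosedFieldType) (A : algType C).

(* [pure (face i u)] is d_i (u_0 (x) ... (x) u_(n+1)); the last face, i = n+1,
   is the wrap-around one u_(n+1) u_0 (x) u_1 (x) ... (x) u_n. *)
Definition face n (i : 'I_n.+2) (u : 'I_n.+2 -> A) : 'I_n.+1 -> A := fun j =>
  if i == ord_max then
    if j == ord0 then u ord_max * u ord0 else u (widen_ord (leqnSn _) j)
  else if (j < i)%N then u (widen_ord (leqnSn _) j)
  else if j == i :> nat then u (widen_ord (leqnSn _) j) * u (lift ord0 j)
  else u (lift ord0 j).

Definition dface n (i : 'I_n.+2) : tpow A n.+2 -> tpow A n.+1 :=
  tlift (fun u => pure (face i u)).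

(* [ordS] is the cyclic successor, so that [rotate u] = (u_1, ..., u_n, u_0). *)
Definition rotate n (u : 'I_n.+1 -> A) : 'I_n.+1 -> A := fun j => u (ordS j).

Definition tcyc n : tpow A n.+1 -> tpow A n.+1 :=
  tlift (fun u => (-1) ^+ n *: pure (rotate u)).

(* The Hochschild boundary beta = sum_i (-1)^i d_i. *)
Definition hb n (x : tpow A n.+2) : tpow A n.+1 :=
  \sum_(i < n.+2) (-1) ^+ i *: dface i x.

Lemma pure_slots m n (F : ('I_m -> A) -> 'I_n -> A) (s : 'I_m -> 'I_n) :
  (forall k u w, (forall j, j != k -> w j = u j) ->
     forall j, j != s k -> F w j = F u j) ->
  (forall k u v w, w k = u k + v k ->
     (forall j, j != k -> w j = u j /\ w j = v j) ->
     F w (s k) = F u (s k) + F v (s k)) ->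
  (forall k c u w, w k = c *: u k -> (forall j, j != k -> w j = u j) ->
     F w (s k) = c *: F u (s k)) ->
  multilinear (fun u => pure (F u)).
Proof.
move=> off onD onZ; have [pD pZ] := @pure_multilinear C A n.
split=> [k u v w wk wo|k c u w wk wo].
- apply: (pD (s k)); first exact: onD wk wo.
  by move=> j jk; split; apply: off jk => l /wo[].
- by apply: (pZ (s k)); [exact: onZ wk wo|exact: off wo].
Qed.

Definition face_slot n (i k : 'I_n.+2) : 'I_n.+1 :=
  if i == ord_max then inord (if k == ord_max then 0%N else val k)
  else inord (if (k <= i)%N then val k else k.-1).

Lemma face_multilinear n (i : 'I_n.+2) : multilinear (fun u => pure (face i u)).
Proof.
have valW (j : 'I_n.+1) : val (widen_ord (leqnSn n.+1) j) = j by [].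
have ordN (k : 'I_n.+2) : k != ord_max -> (k < n.+1)%N.
  by rewrite -val_eqE /= => kn; rewrite ltn_neqAle kn -ltnS ltn_ord.
have slotE (k : 'I_n.+2) : face_slot i k =
    (if i == ord_max then if k == ord_max then 0%N else val k
     else if (k <= i)%N then val k else k.-1) :> nat.
  rewrite /face_slot; case: ifP => im.
    by rewrite inordK //; case: ifP => // /negbT /ordN.
  rewrite inordK //; case: (leqP k i) => ki.
    exact: leq_ltn_trans ki (ordN _ (negbT im)).
  by rewrite ltnS -subn1 leq_subLR -ltnS ltn_ord.
have cases (k : 'I_n.+2) : exists g : ('I_n.+2 -> A) -> A -> A,
    [/\ forall u, face i u (face_slot i k) = g u (u k),
        forall u w, (forall j, j != k -> w j = u j) -> g w =1 g u,
        forall u x y, g u (x + y) = g u x + g u y &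
        forall u c x, g u (c *: x) = c *: g u x].
  have sl := slotE k.
  case: (eqVneq i ord_max) => [im|im].
    subst i; rewrite eqxx in sl.
    case: (eqVneq k ord_max) => [km|km].
      have sl0 : face_slot ord_max k == ord0.
        by rewrite -val_eqE /= sl km eqxx.
      exists (fun u x => x * u ord0); split.
      - by move=> u; rewrite /face eqxx sl0 km.
      - by move=> u w wu x; rewrite wu // km.
      - by move=> *; rewrite mulrDl.
      - by move=> *; rewrite scalerAl.
    rewrite (negbTE km) in sl.
    case: (eqVneq k ord0) => [k0|k0].
      have sl0 : face_slot ord_max k == ord0 by rewrite -val_eqE /= sl k0.
      exists (fun u x => u ord_max * x); split.
      - by move=> u; rewrite /face eqxx sl0 k0.
      - by move=> u w wu x; rewrite wu // eq_sym.
      - by move=> *; rewrite mulrDr.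
      - by move=> *; rewrite scalerAr.
    have sl0 : (face_slot ord_max k == ord0) = false.
      by rewrite -val_eqE /= sl; apply/negbTE; rewrite -val_eqE in k0.
    exists (fun u x => x); split => // u.
    by rewrite /face eqxx sl0; congr (u _); apply: val_inj; rewrite /= sl.
  rewrite (negbTE im) in sl.
  case: (ltngtP k i) => ki.
  - rewrite (ltnW ki) in sl; exists (fun u x => x); split => // u.
    rewrite /face (negbTE im) sl ki.
    by congr (u _); apply: val_inj; rewrite /= sl.
  - rewrite leqNgt ki /= in sl.
    have k0 : (0 < k)%N by apply: leq_trans ki.
    have lk : lift ord0 (face_slot i k) = k.
      by apply: val_inj; rewrite /= /bump leq0n add1n sl prednK.
    case: (eqVneq (k : nat) i.+1) => ki1.
      rewrite ki1 /= in sl.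
      exists (fun u x => u (widen_ord (leqnSn _) (face_slot i k)) * x); split.
      - by move=> u; rewrite /face (negbTE im) sl ltnn eqxx lk.
      - move=> u w wu x; rewrite wu // -val_eqE /= sl.
        by rewrite ki1 ltn_eqF.
      - by move=> *; rewrite mulrDr.
      - by move=> *; rewrite scalerAr.
    exists (fun u x => x); split => // u.
    have ik : (i < k.-1)%N.
      by rewrite -ltnS prednK // ltn_neqAle eq_sym ki1 ki.
    by rewrite /face (negbTE im) sl ltnNge (ltnW ik) gtn_eqF //= lk.
  - rewrite ki leqnn in sl.
    have wk : widen_ord (leqnSn _) (face_slot i k) = k.
      by apply: val_inj; rewrite /= sl ki.
    exists (fun u x => x * u (lift ord0 (face_slot i k))); split.
    - by move=> u; rewrite /face (negbTE im) sl /= ki ltnn eqxx wk.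
    - move=> u w wu x; rewrite wu // -val_eqE /= /bump leq0n add1n sl /= ki.
      by rewrite gtn_eqF.
    - by move=> *; rewrite mulrDl.
    - by move=> *; rewrite scalerAl.
apply: (@pure_slots _ _ _ (face_slot i)).
- move=> k u w wu j; rewrite -val_eqE /= slotE /face.
  case: ifP => im.
    case: (eqVneq j ord0) => [->|j0].
      move=> h; rewrite !wu //.
        by apply: contraNneq h => <-.
      by apply: contraNneq h => <-; rewrite eqxx.
    move=> h; rewrite wu //; apply: contraNneq h => <-.
    case: ifP => // /eqP /(congr1 val) /= jn.
    by have := ltn_ord j; rewrite jn ltnn.
  case: (ltngtP j i) => ji h.
  - by rewrite wu //; apply: contraNneq h => <-; rewrite /= (ltnW ji).
  - rewrite wu //; apply: contraNneq h => <-; rewrite /= /bump leq0n add1n.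
    by rewrite leqNgt ltnS (ltnW ji).
  - rewrite !wu //; apply: contraNneq h => <-; rewrite /= ?/bump ?leq0n ?add1n ji.
      by rewrite ltnn.
    by rewrite leqnn.
- move=> k u v w wk wo; have [g [gE gI gD _]] := cases k.
  rewrite !gE wk gD; congr (_ + _); apply: gI => j /wo[//].
- move=> k c u w wk wo; have [g [gE gI _ gZ]] := cases k.
  by rewrite !gE wk gZ; congr (_ *: _); apply: gI.
Qed.

Lemma rotate_multilinear n :
  multilinear (fun u : 'I_n.+1 -> A => (-1) ^+ n *: pure (rotate u)).
Proof.
have [hD hZ] : multilinear (fun u : 'I_n.+1 -> A => pure (rotate u)).
  apply: (@pure_slots _ _ _ (@ord_pred _)) => [k u w wu j jk|k u v w wk _|].
  - by rewrite /rotate wu //; apply: contraNneq jk => <-; rewrite ordSK.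
  - by rewrite /rotate ord_predK.
  - by move=> k c u w wk _; rewrite /rotate ord_predK.
split=> [k u v w wk wo|k c u w wk wo].
- by rewrite (hD _ _ _ _ wk wo) scalerDr.
- by rewrite (hZ _ _ _ _ wk wo) !scalerA mulrC.
Qed.

HB.instance Definition _ n (i : 'I_n.+2) :=
  GRing.isLinear.Build C (tpow A n.+2) (tpow A n.+1) _ (@dface n i)
    (tlift_linear (@face_multilinear n i)).

HB.instance Definition _ n :=
  GRing.isLinear.Build C (tpow A n.+1) (tpow A n.+1) _ (@tcyc n)
    (tlift_linear (@rotate_multilinear n)).

Lemma dface_pure n (i : 'I_n.+2) u : dface i (pure u) = pure (face i u).
Proof. exact/tlift_pure/face_multilinear. Qed.

Lemma tcyc_pure n (u : 'I_n.+1 -> A) :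
  tcyc (pure u) = (-1) ^+ n *: pure (rotate u).
Proof. exact/tlift_pure/rotate_multilinear. Qed.

Lemma hb_linear n : linear (@hb n).
Proof.
move=> c x y; rewrite /hb scaler_sumr -big_split /=; apply: eq_bigr => i _.
by rewrite linearP scalerDr !scalerA mulrC.
Qed.
HB.instance Definition _ n :=
  GRing.isLinear.Build C (tpow A n.+2) (tpow A n.+1) _ (@hb n) (@hb_linear n).

Lemma face_rotate n (i : 'I_n.+1) (u : 'I_n.+2 -> A) :
  face (widen_ord (leqnSn _) i) (rotate u) = rotate (face (lift ord0 i) u).
Proof.
have eu (x y : 'I_n.+2) : x = y :> nat -> u x = u y by move/val_inj => ->.
have im : (widen_ord (leqnSn n.+1) i == ord_max) = false.
  by rewrite -val_eqE /= ltn_eqF.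
have lm : (lift ord0 i == ord_max) = (i == n :> nat) by rewrite -val_eqE.
apply/funext => j; rewrite /face /rotate im lm /=.
have [jn|jn] := eqVneq (j : nat) n.
  have -> : (ordS j == ord0) by rewrite -val_eqE /= jn modnn.
  rewrite jn modnn [(0 < bump 0 i)%N]isT.
  case: ltngtP => [ni|ni|ni].
  - by have := ltn_ord i; rewrite ltnS leqNgt ni.
  - by apply: eu; rewrite /= /bump leq0n add1n jn ?modnn.
  - congr (_ * _); apply: eu.
      by rewrite /= jn modn_small.
    by rewrite /= /bump leq0n add1n jn ?modnn.
have jlt : (j < n)%N by rewrite ltn_neqAle jn -ltnS ltn_ord.
have jS : (j.+1 %% n.+1 = j.+1)%N by rewrite modn_small.
have -> : (ordS j == ord0) = false by rewrite -val_eqE /= jS.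
rewrite jS /= ?/bump ?leq0n ?add1n ltnS eqSS.
have u1 : u (ordS (widen_ord (leqnSn n.+1) j)) =
          u (widen_ord (leqnSn n.+1) (ordS j)).
  by apply: eu; rewrite /= jS modn_small // ltnS ltnW.
have u2 : u (ordS (lift ord0 j)) = u (lift ord0 (ordS j)).
  by apply: eu; rewrite /= /bump !leq0n !add1n jS modn_small.
rewrite u1 u2; case: (eqVneq (i : nat) n) => [ni|_] //.
by rewrite ni jlt.
Qed.

Lemma face_rotate_last n (u : 'I_n.+2 -> A) :
  face ord_max (rotate u) = face ord0 u.
Proof.
have eu (x y : 'I_n.+2) : x = y :> nat -> u x = u y by move/val_inj => ->.
apply/funext => j; rewrite /face /rotate eqxx /=.
have -> : (j == ord0) = (j == 0 :> nat) by rewrite -val_eqE.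
case: eqP => [j0|_].
  by congr (_ * _); apply: eu; rewrite /= ?modnn ?j0 // modn_small.
by apply: eu; rewrite /= /bump leq0n add1n modn_small // ltnS.
Qed.

Lemma dface_tcyc n (i : 'I_n.+1) (y : tpow A n.+2) :
  dface (widen_ord (leqnSn _) i) (tcyc y) = - tcyc (dface (lift ord0 i) y).
Proof.
elim/tpow_ind: y => [u||x y ihx ihy|c x ihx].
- rewrite tcyc_pure linearZ /= !dface_pure face_rotate tcyc_pure exprS.
  by rewrite mulN1r scaleNr.
- by rewrite !raddf0.
- by rewrite !raddfD /= ihx ihy ?opprD.
- by rewrite !linearZ /= ihx ?scalerN.
Qed.

Lemma dface_tcyc_last n (y : tpow A n.+2) :
  dface ord_max (tcyc y) = (-1) ^+ n.+1 *: dface ord0 y.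
Proof.
elim/tpow_ind: y => [u||x y ihx ihy|c x ihx].
- by rewrite tcyc_pure linearZ /= !dface_pure face_rotate_last.
- by rewrite !raddf0.
- by rewrite !raddfD /= ihx ihy ?scalerDr.
- by rewrite !linearZ /= ihx // !scalerA mulrC.
Qed.

Lemma hb_tcyc n (y : tpow A n.+2) :
  exists w : tpow A n.+1, hb (y - tcyc y) = w - tcyc w.
Proof.
pose w := \sum_(i < n.+1) (-1) ^+ i.+1 *: dface (lift ord0 i) y.
have hy : hb y = dface ord0 y + w.
  by rewrite /hb big_ord_recl expr0 scale1r.
have ht : hb (tcyc y) = tcyc w + dface ord0 y.
  rewrite /hb big_ord_recr /= dface_tcyc_last scalerA -exprD addnn.
  rewrite -mul2n exprM sqrrN !expr1n scale1r; congr (_ + _).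
  rewrite raddf_sum /=; apply: eq_bigr => i _.
  by rewrite dface_tcyc scalerN [in RHS]linearZ /= exprS mulN1r scaleNr.
by exists w; rewrite raddfB /= hy ht [_ + w]addrC opprD addrACA subrr addr0.
Qed.

(* The image of 1 - t; [Clam n] is the group C^lambda_n of the Connes complex
   and [Hlam n] its n-th homology group, cycles modulo boundaries. *)
Definition im_1t n : pred (tpow A n.+1) := fun x =>
  `[< exists y, x = y - tcyc y >].

Fact im_1t_zmod n : zmod_closed (@im_1t n).
Proof.
split; first by apply/asboolP; exists 0; rewrite raddf0 subr0.
move=> x y /asboolP[x' ->] /asboolP[y' ->]; apply/asboolP; exists (x' - y').
by rewrite (raddfB (@tcyc n)) /= !opprD !opprK addrACA.
Qed.
HB.instance Definition _ n := GRing.isZmodClosed.Build (tpow A n.+1) (@im_1t n)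
  (@im_1t_zmod n).

Definition im_1t_closed n : zmodClosed (tpow A n.+1) :=
  GRing.ZmodClosed.clone _ (@im_1t n) _.

Definition Clam n : Type := Quotient.quot (im_1t_closed n).
HB.instance Definition _ n := GRing.Zmodule.on (Clam n).

Definition Clam_class n (x : tpow A n.+1) : Clam n :=
  \pi_(Quotient.quot (im_1t_closed n)) x.

Lemma Clam_classP n (x y : tpow A n.+1) :
  Clam_class x = Clam_class y <-> exists w, x - y = w - tcyc w.
Proof.
split=> [/eqP|[w xy]].
  by rewrite -Quotient.idealrBE => /asboolP.
by apply/eqP; rewrite -Quotient.idealrBE; apply/asboolP; exists w.
Qed.

Lemma Clam_class_zmod n : zmod_morphism (@Clam_class n).
Proof. by move=> x y; rewrite /Clam_class raddfB. Qed.
HB.instance Definition _ n := GRing.isZmodMorphism.Build (tpow A n.+1) (Clam n)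
  (@Clam_class n) (@Clam_class_zmod n).

Lemma Clam_ind n (P : Clam n -> Prop) :
  (forall x, P (Clam_class x)) -> forall x, P x.
Proof. by move=> h x; rewrite -[x]reprK; apply: h. Qed.

(* The boundary of the Connes complex, induced by [hb] on the quotients. *)
Definition hb_lam n (x : Clam n.+1) : Clam n := Clam_class (hb (repr x)).

Lemma hb_lam_class n (x : tpow A n.+2) :
  hb_lam (Clam_class x) = Clam_class (hb x).
Proof.
have [] := (Clam_classP (repr (Clam_class x)) x).1; first exact: reprK.
move=> w rx; apply/Clam_classP; have [w' hw] := hb_tcyc w.
by exists w'; rewrite -raddfB /= rx.
Qed.

Lemma hb_lam_zmod n : zmod_morphism (@hb_lam n).
Proof.
elim/Clam_ind=> x; elim/Clam_ind=> y.
by rewrite -raddfB !hb_lam_class !raddfB.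
Qed.
HB.instance Definition _ n := GRing.isZmodMorphism.Build (Clam n.+1) (Clam n)
  (@hb_lam n) (@hb_lam_zmod n).

Definition is_cycle n : pred (Clam n) :=
  match n with
  | 0 => fun _ => true
  | m.+1 => fun x => hb_lam x == 0
  end.

Fact is_cycle_zmod n : zmod_closed (@is_cycle n).
Proof.
case: n => [//|n]; split; first by rewrite unfold_in /= raddf0.
move=> x y; rewrite !unfold_in /= => /eqP hx /eqP hy.
by rewrite raddfB /= hx hy subrr.
Qed.
HB.instance Definition _ n := GRing.isZmodClosed.Build (Clam n) (@is_cycle n)
  (@is_cycle_zmod n).

Record Zlam n : Type := MkZlam { Zlam_val : Clam n; _ : is_cycle Zlam_val }.
HB.instance Definition _ n := [isSub for @Zlam_val n].
HB.instance Definition _ n := [Choice of Zlam n by <:].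
HB.instance Definition _ n := [SubChoice_isSubZmodule of Zlam n by <:].

Definition is_boundary n : pred (Zlam n) := fun x =>
  `[< exists y : Clam n.+1, val x = hb_lam y >].

Fact is_boundary_zmod n : zmod_closed (@is_boundary n).
Proof.
split; first by apply/asboolP; exists 0; rewrite !raddf0.
move=> x y /asboolP[x' hx] /asboolP[y' hy]; apply/asboolP; exists (x' - y').
by rewrite !raddfB /= hx hy.
Qed.
HB.instance Definition _ n := GRing.isZmodClosed.Build (Zlam n) (@is_boundary n)
  (@is_boundary_zmod n).

Definition is_boundary_closed n : zmodClosed (Zlam n) :=
  GRing.ZmodClosed.clone _ (@is_boundary n) _.

Definition Hlam n : Type := Quotient.quot (is_boundary_closed n).
HB.instance Definition _ n := GRing.Zmodule.on (Hlam n).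

Definition Hlam_class n (x : Zlam n) : Hlam n :=
  \pi_(Quotient.quot (is_boundary_closed n)) x.

Lemma Hlam_class_zmod n : zmod_morphism (@Hlam_class n).
Proof. by move=> x y; rewrite /Hlam_class raddfB. Qed.
HB.instance Definition _ n := GRing.isZmodMorphism.Build (Zlam n) (Hlam n)
  (@Hlam_class n) (@Hlam_class_zmod n).

Lemma Hlam_class_eq0 n (x : Zlam n) :
  Hlam_class x = 0 <-> exists y, val x = hb_lam y.
Proof.
split=> [x0|[y xy]].
  have /eqP : Hlam_class x = Hlam_class 0 by rewrite x0 (raddf0 (@Hlam_class n)).
  by rewrite -Quotient.idealrBE subr0 => /asboolP.
have <- : Hlam_class 0 = 0 := raddf0 (@Hlam_class n).
apply/eqP; rewrite -Quotient.idealrBE subr0.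
by apply/asboolP; exists y.
Qed.

(* Tr (M_0 (x) ... (x) M_(n-1)). *)
Definition gtrace k n (M : 'I_n -> 'M[A]_k) : tpow A n :=
  \sum_(j : {ffun 'I_n -> 'I_k}) pure (fun i => M i (j i) (j (ordS i))).

Section Chern.
Variables (k : nat) (G : 'M[A]_k) (GG : G *m G = G).

Definition ch_chain n : Clam n.*2 :=
  Clam_class ((-1) ^+ n *: gtrace (fun _ : 'I_n.*2.+1 => G)).

Lemma gtrace_tcyc n :
  tcyc (gtrace (fun _ : 'I_n.+1 => G)) =
  (-1) ^+ n *: gtrace (fun _ : 'I_n.+1 => G).
Proof.
rewrite /gtrace raddf_sum /= scaler_sumr.
pose h (j : {ffun 'I_n.+1 -> 'I_k}) : {ffun 'I_n.+1 -> 'I_k} :=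
  [ffun i => j (ord_pred i)].
rewrite (reindex h) /=; last first.
  exists (fun j => [ffun i => j (ordS i)]) => j _; apply/ffunP => i.
    by rewrite !ffunE ordSK.
  by rewrite !ffunE ord_predK.
apply: eq_bigr => j _; rewrite tcyc_pure; congr (_ *: pure _).
by apply/funext => i; rewrite /rotate /h !ffunE !ordSK.
Qed.

Lemma pure_sum n (I : finType) (i : 'I_n) (u : 'I_n -> A) (F : I -> A) :
  pure (fun j => if j == i then \sum_c F c else u j) =
  \sum_c pure (fun j => if j == i then F c else u j).
Proof.
have [pD pZ] := @pure_multilinear C A n.
pose f x := pure (fun j => if j == i then x else u j).
rewrite -[LHS]/(f _) (big_morph f (id1 := 0) (op1 := +%R)) //.
  move=> x y; apply: (pD i); first by rewrite eqxx.
  by move=> j /negbTE ->.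
rewrite -[RHS](scale0r (f 0)); apply: (pZ i); first by rewrite eqxx scale0r.
by move=> j /negbTE ->.
Qed.

Lemma dface_gtrace n (i : 'I_n.+2) : i != ord_max ->
  dface i (gtrace (fun _ : 'I_n.+2 => G)) = gtrace (fun _ : 'I_n.+1 => G).
Proof.
move=> im; have i_lt : (i < n.+1)%N.
  by rewrite ltn_neqAle -ltnS ltn_ord andbT; rewrite -val_eqE in im.
pose i' := Ordinal i_lt; pose p : 'I_n.+2 := lift ord0 i'.
rewrite /gtrace raddf_sum /=.
pose h (jc : {ffun 'I_n.+1 -> 'I_k} * 'I_k) : {ffun 'I_n.+2 -> 'I_k} :=
  [ffun x => oapp jc.1 jc.2 (unlift p x)].
have hp jc : h jc p = jc.2 by rewrite ffunE unlift_none.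
have hl jc (l : 'I_n.+1) (x : 'I_n.+2) :
    x = lift p l :> nat -> h jc x = jc.1 l.
  by move=> /val_inj ->; rewrite ffunE liftK.
rewrite (reindex h) /=; last first.
  exists (fun j => ([ffun l => j (lift p l)], j p)) => [[j c]|j] _.
    by rewrite hp; congr (_, _); apply/ffunP => l; rewrite ffunE (@hl _ l).
  apply/ffunP => x; rewrite ffunE /=.
  by case: unliftP => [l|] ->; rewrite /= ?ffunE.
rewrite -(pair_bigA _ (fun j c => dface i (pure
  (fun x => G (h (j, c) x) (h (j, c) (ordS x)))))) /=.
apply: eq_bigr => j _.
have -> : (fun l => G (j l) (j (ordS l))) = (fun l => if l == i' then
    \sum_c G (j i') c * G c (j (ordS i')) else G (j l) (j (ordS l))).
  by apply/funext => l; case: eqP => // ->; rewrite -[in LHS]GG mxE.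
rewrite pure_sum; apply: eq_bigr => c _; rewrite dface_pure.
congr pure; apply/funext => l; rewrite /face (negbTE im) -val_eqE /=.
have liftE (m : 'I_n.+1) : lift p m = (if (m <= i)%N then m : nat else m.+1) :> nat.
  by rewrite /= [bump _ _]/(((i < m) + m)%N) ltnNge; case: leqP.
have lift0E (m : 'I_n.+1) : lift ord0 m = m.+1 :> nat by [].
have liftS (m : 'I_n.+1) : (i <= m)%N ->
    ordS (lift ord0 m) = lift p (ordS m) :> nat.
  move=> im'; rewrite liftE /= /bump leq0n add1n.
  case: (eqVneq (m : nat) n) => [->|mn]; first by rewrite !modnn.
  have lt : (m < n)%N by rewrite ltn_neqAle mn -ltnS ltn_ord.
  by rewrite !modn_small ?ltnS // ltnNge im'.
case: ltngtP => li.
- have ln : (l < n)%N by rewrite (leq_trans li) // -ltnS.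
  have e1 : widen_ord (leqnSn n.+1) l = lift p l :> nat.
    by rewrite liftE (ltnW li).
  have e2 : ordS (widen_ord (leqnSn n.+1) l) = lift p (ordS l) :> nat.
    by rewrite liftE /= !modn_small ?li // !ltnS // ltnW.
  by rewrite (hl _ _ _ e1) (hl _ _ _ e2); case: (eqVneq l i') li => // ->; rewrite ltnn.
- have e1 : lift ord0 l = lift p l :> nat by rewrite liftE leqNgt li.
  rewrite (hl _ _ _ e1) (hl _ _ _ (liftS _ (ltnW li))).
  by case: (eqVneq l i') li => // ->; rewrite ltnn.
- have li' : l = i' by apply: val_inj.
  have e1 : widen_ord (leqnSn n.+1) l = lift p i' :> nat.
    by rewrite liftE /= li leqnn.
  rewrite (hl _ _ _ e1) (hl _ _ _ (liftS _ _)) ?li //.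
  have -> : lift ord0 l = p by rewrite li'.
  have -> : ordS (widen_ord (leqnSn n.+1) l) = p.
    by apply: val_inj; rewrite /= li modn_small.
  by rewrite hp li'.
Qed.

Lemma dface_max_gtrace n :
  dface ord_max (gtrace (fun _ : 'I_n.+2 => G)) =
  gtrace (fun _ : 'I_n.+1 => G).
Proof.
have /(congr1 (dface ord_max)) := gtrace_tcyc n.+1.
rewrite dface_tcyc_last dface_gtrace // linearZ /= => /(congr1 ( *:%R ((-1) ^+ n.+1))).
by rewrite !scalerA -expr2 sqrr_sign !scale1r.
Qed.

Lemma ch_chain_cycle n : is_cycle (ch_chain n).
Proof.
case: n => [//|n].
suff : hb_lam (Clam_class ((-1) ^+ n.+1 *:
    gtrace (fun _ : 'I_n.*2.+3 => G))) == 0 by [].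
rewrite hb_lam_class.
pose y : tpow A n.*2.+2 := gtrace (fun _ : 'I_n.*2.+2 => G).
have -> : hb ((-1) ^+ n.+1 *: gtrace (fun _ : 'I_n.*2.+3 => G)) =
          (-1) ^+ n.+1 *: y.
  rewrite linearZ /=; congr (_ *: _); rewrite /hb.
  rewrite (eq_bigr (fun i : 'I_n.*2.+3 => (-1) ^+ i *: y)); last first.
    move=> i _; congr (_ *: _); case: (eqVneq i ord_max) => [->|im].
      exact: dface_max_gtrace.
    exact: dface_gtrace.
  rewrite -scaler_suml.
  have sgn m : \sum_(i < m.*2.+1) (-1) ^+ i = 1 :> C.
    elim: m => [|m IHm]; first by rewrite big_ord1.
    rewrite doubleS big_ord_recr big_ord_recr /= IHm.
    by rewrite [(-1) ^+ m.*2.+2]exprS mulN1r addrK.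
  have -> : \sum_(i < n.*2.+3) (-1) ^+ i = 1 :> C := sgn n.+1.
  by rewrite scale1r.
have -> : (0 : Clam n.*2.+1) = Clam_class 0 by rewrite raddf0.
apply/eqP/Clam_classP; exists ((1 / 2) *: ((-1) ^+ n.+1 *: y)).
have ty : tcyc y = - y.
  by rewrite /y gtrace_tcyc exprS -mul2n exprM sqrrN !expr1n mulr1 scaleN1r.
set e := _ *: y; have te : tcyc e = - e by rewrite linearZ /= ty scalerN.
by rewrite subr0 [tcyc (_ *: e)]linearZ /= te scalerN opprK -scalerDl -splitr scale1r.
Qed.

(* The class of Tr ((-1)^n G^(x)(2n+1)), an element of H^lambda_(2n). *)
Definition ch_lambda n : Hlam n.*2 := Hlam_class (MkZlam (ch_chain_cycle n)).

End Chern.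

(* The pairing of an idempotent G with a cyclic 0-cocycle phi. *)
Definition pairing0 k (phi : A -> C) (G : 'M[A]_k) : C := phi (\tr G).

End CyclicHomology.
Section HilbertSpace.
Variable R : realType.
Local Open Scope complex_scope.
Local Open Scope classical_set_scope.

Definition sqmod (z : R[i]) : R := complex.Re z ^+ 2 + complex.Im z ^+ 2.

Definition sqnorm (u : nat * nat -> R[i]) : \bar R :=
  \esum_(n in [set: nat * nat]) (sqmod (u n))%:E.

Definition in_ell2 : pred (nat * nat -> R[i]) := fun u =>
  `[< (sqnorm u < +oo)%E >].

Lemma sqmod_ge0 z : 0 <= sqmod z.
Proof. by rewrite addr_ge0 ?sqr_ge0. Qed.

Lemma sqmodM z w : sqmod (z * w) = sqmod z * sqmod w.
Proof. by case: z w => [a b] [c d]; rewrite /sqmod /=; ring. Qed.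

Lemma sqmodD z w : sqmod (z + w) <= 2 * sqmod z + 2 * sqmod w.
Proof.
case: z w => [a b] [c d]; rewrite /sqmod /=.
by have := sqr_ge0 (a - c); have := sqr_ge0 (b - d); nra.
Qed.

Lemma le_esumZ (k : R) (f : nat * nat -> \bar R) : 0 <= k ->
  (forall n, 0 <= f n)%E ->
  (\esum_(n in [set: nat * nat]) (k%:E * f n) <=
   k%:E * \esum_(n in [set: nat * nat]) f n)%E.
Proof.
move=> k0 f0; apply: ge_ereal_sup => _ [X [finX XT] <-].
rewrite -ge0_mule_fsumr //; apply: lee_wpmul2l; first by rewrite lee_fin.
by apply: esum_ge; exists X.
Qed.

Lemma in_ell2_submod : submod_closed in_ell2.
Proof.
split; first by apply/asboolP; rewrite /sqnorm esum1 // => n _;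
  rewrite /sqmod /= expr0n addr0.
move=> c u v /asboolP hu /asboolP hv; apply/asboolP.
have sE0 (w : nat * nat -> R[i]) n : (0 <= (sqmod (w n))%:E)%E.
  by rewrite lee_fin sqmod_ge0.
have k0 : 0 <= 2 * sqmod c by rewrite mulr_ge0 ?sqmod_ge0.
have kE0 (k : R) (w : nat * nat -> R[i]) n : 0 <= k ->
    (0 <= k%:E * (sqmod (w n))%:E)%E.
  by move=> ?; rewrite mule_ge0 ?lee_fin ?sqmod_ge0.
apply: (@le_lt_trans _ _ (\esum_(n in [set: nat * nat])
    ((2 * sqmod c)%:E * (sqmod (u n))%:E + 2%:E * (sqmod (v n))%:E)%E)).
  apply: le_esum => n _; rewrite -!EFinM -EFinD lee_fin.
  by rewrite -mulrA -sqmodM; exact: sqmodD.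
rewrite esumD; try by move=> n _; apply: kE0.
apply: lte_add_pinfty.
- by apply: le_lt_trans (le_esumZ k0 (sE0 u)) _; rewrite lte_mul_pinfty // lee_fin.
- by apply: le_lt_trans (le_esumZ _ (sE0 v)) _ => //; rewrite lte_mul_pinfty // lee_fin.
Qed.
HB.instance Definition _ := GRing.isSubmodClosed.Build R[i]
  (nat * nat -> R[i]) in_ell2 (GRing.submod_closed_semi in_ell2_submod).

(* The Hilbert space l^2(N) (x) l^2(N), identified with l^2(N x N). *)
Record ell2 : Type := MkEll2 {
  ell2_val :> nat * nat -> R[i]; _ : in_ell2 ell2_val }.
HB.instance Definition _ := [isSub for ell2_val].
HB.instance Definition _ := [Choice of ell2 by <:].
HB.instance Definition _ := [SubChoice_isSubLmodule of ell2 by <:].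

Definition ell2norm (u : ell2) : R := Num.sqrt (fine (sqnorm u)).

(* Sum of an absolutely summable complex family indexed by N x N, as the limit
   of its square partial sums (real and imaginary parts separately). *)
Definition csum (f : nat * nat -> R[i]) : R[i] :=
  limn (fun N => \sum_(i < N) \sum_(j < N) complex.Re (f (i : nat, j : nat)))
  +i* limn (fun N => \sum_(i < N) \sum_(j < N) complex.Im (f (i : nat, j : nat))).

(* Inner product, antilinear in the first argument. *)
Definition dot (u v : ell2) : R[i] := csum (fun n => (u n)^* * v n).

Fact in_ell2_ket (n : nat * nat) : in_ell2 (fun m => (m == n)%:R).
Proof.
apply/asboolP; rewrite /sqnorm (_ : esum _ _ = 1%E) ?ltry //.
rewrite -[RHS](@esum_set1 R _ n (fun=> 1%E)) // [RHS]esum_mkcond.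
apply: eq_esum => m _; rewrite /sqmod.
have -> : (m \in [set n]) = (m == n).
  by apply/idP/eqP => [/set_mem|->] //; rewrite inE.
by case: eqVneq => _ /=; rewrite ?expr0n ?expr1n ?addr0.
Qed.
Definition ket (n : nat * nat) : ell2 := MkEll2 (in_ell2_ket n).

Definition bounded_operator (T : ell2 -> ell2) : Prop :=
  linear T /\ exists M : R, forall u, ell2norm (T u) <= M * ell2norm u.

Definition positive_operator (T : ell2 -> ell2) : Prop :=
  bounded_operator T /\ forall u, 0 <= dot u (T u).

(* T is trace class when |T| has finite trace, where P = |T| is the positive
   square root of T^* T. *)
Definition trace_class (T : ell2 -> ell2) : Prop :=
  bounded_operator T /\
  exists P : ell2 -> ell2,
    [/\ positive_operator P, forall u v, dot (P u) (P v) = dot (T u) (T v) &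
        (\esum_(n in [set: nat * nat])
           (complex.Re (dot (ket n) (P (ket n))))%:E < +oo)%E].

(* The trace, set to 0 outside trace class operators. *)
Definition trace (T : ell2 -> ell2) : R[i] :=
  if `[< trace_class T >] then csum (fun n => dot (ket n) (T (ket n))) else 0.

End HilbertSpace.
Section Representations.
Variables (R : realType) (q : R).
Local Open Scope complex_scope.
Local Notation Sigma := (Sigma4 q%:C).

Definition star_character (eps : Sigma -> R[i]) : Prop :=
  [/\ forall c x y, eps (c *: x + y) = c * eps x + eps y,
      eps 1 = 1,
      forall x y, eps (x * y) = eps x * eps y &
      forall x, eps (Sigma4_star x) = (eps x)^*].

Definition star_representation (sigma : Sigma -> ell2 R -> ell2 R) : Prop :=
  [/\ forall x, bounded_operator (sigma x),
      forall c x y u, sigma (c *: x + y) u = c *: sigma x u + sigma y u,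
      forall u, sigma 1 u = u,
      forall x y u, sigma (x * y) u = sigma x (sigma y u) &
      forall x u v, dot (sigma (Sigma4_star x) u) v = dot u (sigma x v)].

Definition is_epsilon (eps : Sigma -> R[i]) : Prop :=
  [/\ star_character eps, eps (gR q%:C) = 0, eps (ga q%:C) = 0 &
      eps (gb q%:C) = 0].

(* For n1 = 0 the coefficient of sigma(a) vanishes, so that the value of
   [n1.-1] is irrelevant there. *)
Definition is_sigma (sigma : Sigma -> ell2 R -> ell2 R) : Prop :=
  [/\ star_representation sigma,
      forall n1 n2 : nat, sigma (gR q%:C) (ket R (n1, n2)) =
        (q ^+ (2 * (n1 + n2)))%:C *: ket R (n1, n2),
      forall n1 n2 : nat, sigma (ga q%:C) (ket R (n1, n2)) =
        (q ^ ((n1 + 2 * n2)%N%:Z - 1) * Num.sqrt (1 - q ^+ (2 * n1)))%:C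
          *: ket R (n1.-1, n2) &
      forall n1 n2 : nat, sigma (gb q%:C) (ket R (n1, n2)) =
        (q ^+ (n1 + n2) * Num.sqrt (1 - q ^+ (2 * n2.+1)))%:C
          *: ket R (n1, n2.+1)].

Definition tr_sigma (eps : Sigma -> R[i]) (sigma : Sigma -> ell2 R -> ell2 R)
    (x : Sigma) : R[i] :=
  trace (fun u => sigma x u - eps x *: u).

End Representations.

(* Main.v *)
(* The projection factors as G = v v^* with v a 4 x 2 matrix over S^7_q whose
   columns are orthonormal, so G^2 = G.

   A character chi of Sigma^4_q yields for every even m the cyclic cocycle
   a_0 (x) ... (x) a_m |-> chi (a_0 ... a_m), which vanishes on boundaries and
   takes the value +-chi (Tr G) on the Chern character of G. The character
   z_4 |-> 1, z_1, z_2, z_3 |-> 0 gives chi (Tr G) = 2, since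
   Tr G = 2 - (1 - q^2)^2 R and chi R = 0.

   As R is self-adjoint, sigma R is diagonal on l^2(N x N); hence
   sigma (Tr G) - eps (Tr G) is minus a positive diagonal operator, whose trace
   is (1 - q^2)^2 sum_(i, j) q^(2 (i + j)) = 1. *)

From HB Require Import structures.
Require Import Defs.
From mathcomp Require Import all_boot all_order all_algebra.
From mathcomp Require Import all_classical all_reals all_analysis.
From mathcomp Require Import complex.
From mathcomp Require Import ring.

Set Implicit Arguments.
Unset Strict Implicit.
Unset Printing Implicit Defensive.

Import Order.TTheory GRing.Theory Num.Theory.

Local Open Scope ring_scope.

(** * Cyclic cocycles obtained from a character *)

Section MultiplicativeCocycle.
Variables (C : numClosedFieldType) (A : algType C) (chi : {rmorphism A -> C}).
Hypothesis chiZ : forall c x, chi (c *: x) = c * chi x.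

Definition char_prod n (u : 'I_n -> A) : C := \prod_i chi (u i).

Lemma char_prod_multilinear n :
  multilinear (W := C^o) (@char_prod n).
Proof.
split=> [i u v w wi wj|i c u w wi wj]; rewrite /char_prod.
  rewrite (bigD1 i) //= [in RHS](bigD1 i) //= [X in _ = _ + X](bigD1 i) //= wi.
  rewrite rmorphD mulrDl; congr (_ * _ + _ * _); apply: eq_bigr => j /wj.
    by case=> ->.
  by case=> _ ->.
rewrite (bigD1 i) //= [in RHS](bigD1 i) //= wi chiZ -mulrA.
by congr (_ * (_ * _)); apply: eq_bigr => j /wj ->.
Qed.

Definition char_cocycle n : tpow A n -> C^o := tlift (W := C^o) (@char_prod n).

HB.instance Definition _ n := GRing.isLinear.Build C (tpow A n) C^o _
  (@char_cocycle n) (tlift_linear (@char_prod_multilinear n)).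

Lemma char_cocycle_pure n (u : 'I_n -> A) :
  char_cocycle (pure u) = char_prod u.
Proof. exact/tlift_pure/char_prod_multilinear. Qed.

(** A face multiplies two cyclically adjacent factors, which a multiplicative [chi] with values in a
    commutative field cannot detect. *)
Lemma char_prod_face n (i : 'I_n.+2) (u : 'I_n.+2 -> A) :
  char_prod (face i u) = char_prod u.
Proof.
rewrite /char_prod; have [->|im] := eqVneq i ord_max.
  (* Wrap-around face: its slot 0 carries both end factors, so both ends are split off on the
     right. *)
  rewrite big_ord_recl [RHS]big_ord_recr /= [in RHS]big_ord_recl.
  rewrite {1}/face !eqxx rmorphM [RHS]mulrC mulrA; congr (_ * chi (u _) * _).
    by apply: val_inj.
  by apply: eq_bigr => j _; rewrite /face eqxx.
have i_lt : (i < n.+1)%N.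
  by rewrite ltn_neqAle -ltnS ltn_ord andbT; rewrite -val_eqE in im.
(* An inner face absorbs slot [p] = i + 1 into slot i. The remaining slots are enumerated by
   [lift p], and the factor at [p] is handed back to [i']. *)
pose i' := Ordinal i_lt; pose p : 'I_n.+2 := lift ord0 i'.
rewrite [RHS](bigD1_ord p) //=.
rewrite (eq_bigr (fun l =>
    chi (u (lift p l)) * (if l == i' then chi (u p) else 1))).
  by rewrite big_split /= -big_mkcond big_pred1_eq mulrC.
have lift_lt (l : 'I_n.+1) : (l <= i)%N -> widen_ord (leqnSn n.+1) l = lift p l.
  move=> li; apply: val_inj.
  by rewrite /= [bump _ _](_ : _ = (i < l) + l)%N // ltnNge li.
have lift_gt (l : 'I_n.+1) : (i < l)%N -> lift ord0 l = lift p l.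
  move=> li; apply: val_inj.
  by rewrite /= [bump _ l in RHS](_ : _ = (i < l) + l)%N // li.
move=> l _; rewrite /face (negbTE im) -val_eqE /=; case: ltngtP => li.
- by rewrite mulr1 lift_lt // ltnW.
- by rewrite mulr1 lift_gt.
- rewrite rmorphM lift_lt ?li //; congr (_ * chi (u _)).
  by congr lift; apply: val_inj.
Qed.

Lemma char_cocycle_dface n (i : 'I_n.+2) (x : tpow A n.+2) :
  char_cocycle (dface i x) = char_cocycle x.
Proof.
elim/tpow_ind: x => [u||x y ihx ihy|c x ihx].
- by rewrite dface_pure !char_cocycle_pure char_prod_face.
- by rewrite !raddf0.
- by rewrite !raddfD /= ihx ihy.
- by rewrite !linearZ /= ihx.
Qed.

(** All faces contribute the same value, and an even number of alternating signs adds up to 0. *)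
Lemma char_cocycle_hb n (x : tpow A n.*2.+2) : char_cocycle (hb x) = 0.
Proof.
rewrite /hb raddf_sum /=.
rewrite (eq_bigr (fun i : 'I_n.*2.+2 => (-1) ^+ i *: char_cocycle x));
    last first.
  by move=> i _; rewrite linearZ /= char_cocycle_dface.
rewrite -scaler_suml (_ : \sum_i _ = 0) ?scale0r //.
elim: n {x} => [|n IHn]; first by rewrite !big_ord_recr big_ord0 /= add0r subrr.
rewrite doubleS big_ord_recr big_ord_recr /= IHn add0r.
by rewrite [(-1) ^+ n.*2.+3]exprS mulN1r subrr.
Qed.

(** Rotation permutes the factors of a commutative product, so only the sign built into [tcyc]
    survives. *)
Lemma char_cocycle_tcyc n (x : tpow A n.+1) :
  char_cocycle (tcyc x) = (-1) ^+ n * char_cocycle x.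
Proof.
elim/tpow_ind: x => [u||x y ihx ihy|c x ihx].
- rewrite tcyc_pure linearZ /= !char_cocycle_pure; congr (_ * _).
  rewrite /char_prod [RHS](reindex (@ordS _)) //.
  by exists (@ord_pred _) => j _; rewrite ?ordSK ?ord_predK.
- by rewrite !raddf0 mulr0.
- by rewrite !raddfD /= ihx ihy mulrDr.
- by rewrite !linearZ /= ihx mulrCA.
Qed.

Section Idempotent.
Variables (k : nat) (G : 'M[A]_k) (GG : G *m G = G).

(** By idempotence the last face removes one copy of [G]; the cocycle is blind to faces, so
    everything descends to degree 0. *)
Lemma char_cocycle_gtrace n :
  char_cocycle (gtrace (fun _ : 'I_n.+1 => G)) = chi (\tr G).
Proof.
elim: n => [|n <-]; last first.
  by rewrite -(char_cocycle_dface (n := n) ord_max) (dface_max_gtrace GG).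
rewrite /gtrace /mxtrace !raddf_sum /=.
(* In degree 0 the index functions on ['I_1] are just the diagonal indices. *)
rewrite (reindex (fun i : 'I_k => [ffun _ : 'I_1 => i])) /=; last first.
  exists (fun j => j ord0) => [i|j] _; first by rewrite ffunE.
  by apply/ffunP => i; rewrite ffunE (ord1 i).
apply: eq_bigr => i _.
by rewrite char_cocycle_pure /char_prod big_ord1 !ffunE.
Qed.

(** A bounding [y] would make the chain equal to [hb y] modulo the image of 1 - t. In even degree
    the cocycle kills both, contradicting its value on the chain. *)
Lemma ch_lambda_neq0 n : chi (\tr G) != 0 -> ch_lambda GG n != 0.
Proof.
apply: contraNneq => /Hlam_class_eq0[y /=].
elim/Clam_ind: y => y; rewrite hb_lam_class => /Clam_classP[w].
move=> /(congr1 (@char_cocycle n.*2.+1)).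
rewrite !raddfB /= char_cocycle_hb char_cocycle_tcyc.
rewrite -[(-1) ^+ n.*2]signr_odd odd_double mul1r subrr subr0 linearZ /=.
rewrite char_cocycle_gtrace => /eqP.
by rewrite mulf_eq0 signr_eq0.
Qed.

End Idempotent.
End MultiplicativeCocycle.

(** * The character of the quantum 4-sphere and the trace of the projection *)

Section SphereCharacter.
Variables (C : numClosedFieldType) (q : C).
Local Notation S := (S7 q).
Local Notation pi := (\pi_S)%qT.

Definition S7_char (x : S) : C := seval (repr x).

(** Evaluation respects the defining relations, so the representative chosen by [repr] is
    immaterial. *)
Lemma S7_char_pi x : S7_char (pi x) = seval x.
Proof. exact/(seval_seqv (q := q))/seqv_repr. Qed.

Lemma S7_charZ c x : S7_char (c *: x) = c * S7_char x.
(* The operations of the quotient are by definition [pi] of a term built on representatives, so one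
   evaluation suffices. *)
Proof. by rewrite -[LHS]/(S7_char (pi _)) S7_char_pi. Qed.

Lemma S7_charD x y : S7_char (x + y) = S7_char x + S7_char y.
Proof. by rewrite -[LHS]/(S7_char (pi _)) S7_char_pi. Qed.

Lemma S7_charM x y : S7_char (x * y) = S7_char x * S7_char y.
Proof. by rewrite -[LHS]/(S7_char (pi _)) S7_char_pi. Qed.

Lemma S7_char1 : S7_char 1 = 1.
Proof. by rewrite -[LHS]/(S7_char (pi _)) S7_char_pi. Qed.

Lemma S7_char_gen k : S7_char (sgen q k) = (k == 3 :> nat)%:R.
Proof. by rewrite -[LHS]/(S7_char (pi _)) S7_char_pi. Qed.

Definition Sigma4_char (x : Sigma4 q) : C := S7_char (val x).

Lemma Sigma4_charZ c x : Sigma4_char (c *: x) = c * Sigma4_char x.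
Proof. exact: S7_charZ. Qed.

Lemma Sigma4_char_zmod : zmod_morphism Sigma4_char.
Proof.
by move=> x y; rewrite -[- y]scaleN1r /Sigma4_char S7_charD S7_charZ mulN1r.
Qed.
HB.instance Definition _ := GRing.isZmodMorphism.Build (Sigma4 q) C Sigma4_char
  Sigma4_char_zmod.

Lemma Sigma4_char_monoid : monoid_morphism Sigma4_char.
Proof. by split=> [|x y]; [exact: S7_char1|exact: S7_charM]. Qed.
HB.instance Definition _ := GRing.isMonoidMorphism.Build (Sigma4 q) C
  Sigma4_char Sigma4_char_monoid.

Lemma Sigma4_char_R : Sigma4_char (gR q) = 0.
Proof.
by rewrite /Sigma4_char /= S7_charD !S7_charM !S7_char_gen !mul0r addr0.
Qed.

(** The diagonal coefficients of R add up to 2q^2 - 1 - q^4 = -(1 - q^2)^2. *)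
Lemma mxtrace_Gq : \tr (Gq q) = 2 - (1 - q ^+ 2) ^+ 2 *: gR q.
Proof.
rewrite /mxtrace !big_ord_recr big_ord0 /= !mxE /= add0r.
rewrite -addrA [X in _ + X]addrACA addrCA; congr (_ + _).
rewrite -[X in _ + (- X - _)]scale1r -!scaleNr -!scalerDl.
by congr (_ *: _); ring.
Qed.

Lemma Sigma4_char_mxtrace : Sigma4_char (\tr (Gq q)) = 2.
Proof.
rewrite mxtrace_Gq rmorphB /= Sigma4_charZ Sigma4_char_R.
by rewrite mulr0 subr0 rmorph_nat.
Qed.

End SphereCharacter.

(** * The sphere relations in the quotient and the factorization of the projection *)

Section ProjectionFactorization.
Variables (C : numClosedFieldType) (q : C).
Hypotheses (q_neq0 : q != 0) (q_real : q^* = q).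
Local Notation S := (S7 q).
Local Notation pi := (\pi_S)%qT.
Local Notation "x ^*s" := (sstar x) (at level 2, format "x ^*s").

Lemma sstarK (x : S) : x^*s^*s = x.
Proof. by elim/S7_ind: x => x; rewrite !sstar_pi; apply/S7_piP/seqv_starK. Qed.

Lemma sstarD (x y : S) : (x + y)^*s = x^*s + y^*s.
Proof.
elim/S7_ind: x => x; elim/S7_ind: y => y.
by rewrite -[_ + _]/(sadd _ _) -[RHS]/(sadd _ _) !spiE; apply/S7_piP/seqv_starD.
Qed.

Lemma sstarM (x y : S) : (x * y)^*s = y^*s * x^*s.
Proof.
elim/S7_ind: x => x; elim/S7_ind: y => y.
by rewrite -[_ * _]/(smul _ _) -[RHS]/(smul _ _) !spiE; apply/S7_piP/seqv_starM.
Qed.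

Lemma sstarZ c (x : S) : (c *: x)^*s = c^* *: x^*s.
Proof.
elim/S7_ind: x => x.
rewrite -[_ *: _]/(sscale _ _) -[RHS]/(sscale _ _) !spiE.
exact/S7_piP/seqv_starZ.
Qed.

Lemma sstarB (x y : S) : (x - y)^*s = x^*s - y^*s.
Proof. by rewrite -!scaleN1r sstarD sstarZ rmorphN1. Qed.

Lemma pi_ssum s : pi (ssum s) = \sum_(x <- s) pi x.
Proof.
elim: s => [|x s IHs]; rewrite ?big_nil ?big_cons //= -IHs.
by rewrite -[RHS]/(sadd _ _) spiE.
Qed.

Lemma pi_mulstar (i j : 'I_4) :
  pi (SMul (SGen C i) (SStar (SGen C j))) = sgen q i * (sgen q j)^*s.
Proof. by rewrite -[RHS]/(smul _ (sstar _)) /sgen !spiE. Qed.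

Lemma sgenC (i j : 'I_4) : (i < j)%N ->
  sgen q i * sgen q j = q *: (sgen q j * sgen q i).
Proof.
move=> ij; rewrite -[LHS]/(smul _ _) -[RHS]/(sscale _ (smul _ _)) /sgen !spiE.
exact/S7_piP/seqv_zz.
Qed.

Lemma sgen_starC (i j : 'I_4) : i != j ->
  (sgen q j)^*s * sgen q i = q *: (sgen q i * (sgen q j)^*s).
Proof.
move=> ij; rewrite -[LHS]/(smul (sstar _) _).
rewrite -[RHS]/(sscale _ (smul _ (sstar _))) /sgen !spiE.
exact/S7_piP/seqv_zsz.
Qed.

Lemma sgen_starE (k : 'I_4) : (sgen q k)^*s * sgen q k =
  sgen q k * (sgen q k)^*s +
  (1 - q ^+ 2) *: \sum_(j < 4 | (j < k)%N) sgen q j * (sgen q j)^*s.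
Proof.
rewrite -[LHS]/(smul (sstar (pi _)) (pi _)) !spiE.
have /S7_piP -> := seqv_zszk q k.
rewrite -!spiE pi_ssum big_map big_filter big_enum_cond /=.
rewrite -[RHS]/(sadd (smul _ (sstar _)) (sscale _ _)) /sgen.
congr (sadd _ (sscale _ _)).
by apply: eq_bigr => j _; rewrite pi_mulstar.
Qed.

Lemma sgen_sphere : \sum_(k < 4) sgen q k * (sgen q k)^*s = 1.
Proof.
have /S7_piP := seqv_sphere q.
rewrite pi_ssum big_map big_enum /= => sumE; rewrite -[RHS]/(pi (SOne C)) -sumE.
by apply: eq_bigr => k _; rewrite pi_mulstar.
Qed.

Local Notation z1 := (z1 q).
Local Notation z2 := (z2 q).
Local Notation z3 := (z3 q).
Local Notation z4 := (z4 q).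
Local Notation s1 := (z1 * z1^*s).
Local Notation s2 := (z2 * z2^*s).
Local Notation s3 := (z3 * z3^*s).
Local Notation s4 := (z4 * z4^*s).

Lemma sum_ord4 (V : nmodType) (F : 'I_4 -> V) : \sum_i F i =
  F (Ordinal (isT : 0 < 4)%N) + F (Ordinal (isT : 1 < 4)%N) +
  F (Ordinal (isT : 2 < 4)%N) + F (Ordinal (isT : 3 < 4)%N).
Proof.
rewrite !big_ord_recr big_ord0 /= add0r.
by congr (F _ + F _ + F _ + F _); apply: val_inj.
Qed.

Lemma star_z1z1 : z1^*s * z1 = s1.
Proof. by rewrite sgen_starE big_mkcond sum_ord4 /= !addr0 scaler0 addr0. Qed.

Lemma star_z2z2 : z2^*s * z2 = s2 + (1 - q ^+ 2) *: s1.
Proof. by rewrite sgen_starE big_mkcond sum_ord4 /= !addr0. Qed.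

Lemma star_z3z3 : z3^*s * z3 = s3 + (1 - q ^+ 2) *: (s1 + s2).
Proof. by rewrite sgen_starE big_mkcond sum_ord4 /= !addr0. Qed.

Lemma star_z4z4 : z4^*s * z4 = s4 + (1 - q ^+ 2) *: (s1 + s2 + s3).
Proof. by rewrite sgen_starE big_mkcond sum_ord4 /= !addr0. Qed.

Lemma sphere4 : s1 + s2 + s3 + s4 = 1.
Proof. by rewrite -sgen_sphere sum_ord4. Qed.

(* The matrices v and v^* of the factorization G = v v^*. *)
Definition bundle : 'M[S]_(4, 2) := \matrix_(i, j) nth 0 (nth [::]
  [:: [:: q *: z1;    q *: z2];
      [:: q *: z2^*s; - (q ^+ 2 *: z1^*s)];
      [:: z4;         - z3];
      [:: q *: z3^*s; z4^*s]] i) j.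

Definition bundle_star : 'M[S]_(2, 4) := \matrix_(i, j) nth 0 (nth [::]
  [:: [:: q *: z1^*s; q *: z2;        z4^*s;   q *: z3];
      [:: q *: z2^*s; - (q ^+ 2 *: z1); - z3^*s; z4]] i) j.

(** The adjoint of [sgenC]; the coefficient is unchanged because q is real. *)
Lemma sgen_starstarC (i j : 'I_4) : (i < j)%N ->
  (sgen q j)^*s * (sgen q i)^*s = q *: ((sgen q i)^*s * (sgen q j)^*s).
Proof.
by move=> /sgenC /(congr1 (@sstar _ _)); rewrite sstarZ !sstarM q_real.
Qed.

(** Once every adjoint is moved to the right, the diagonal entries become the sphere relation and
    the off-diagonal terms cancel in pairs. *)
Lemma bundle_isometry : bundle_star *m bundle = 1%:M.
Proof.
apply/matrixP => i j; rewrite !mxE sum_ord4 !mxE.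
case: i => -[|[|//]] ?; case: j => -[|[|//]] ? /=; rewrite ?mulr1n ?mulr0n;
  rewrite -?(scalerAl, scalerAr);
  rewrite ?(mulrN, mulNr, scalerN, opprK, scalerA, mulr1, mul1r).
- rewrite star_z1z1 star_z4z4 -sphere4 !scalerDr.
  (* The four groups of the pattern collect the coefficients of [s1], [s2], [s3] and [s4]. *)
  rewrite (AC ((2*(1*3))*1) ((1*4)*(2*5)*(7*6)*3)) /= -!scalerDl.
  have -> : q * q + (1 - q ^+ 2) = 1 by ring.
  by rewrite !scale1r.
- rewrite [z1^*s * z2]sgen_starC // [z4^*s * z3]sgen_starC // !scalerA.
  rewrite -scalerDl -addrA -scalerDl.
  have -> : q * q * q + - (q * q ^+ 2) = 0 by ring.
  by rewrite mulN1r addNr !scale0r addr0.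
- rewrite [z2^*s * z1]sgen_starC // [z3^*s * z4]sgen_starC // !scalerA.
  rewrite -scalerDl -addrA -scalerDl.
  have -> : q * q * q + - (q ^+ 2 * q) = 0 by ring.
  by rewrite mulN1r addNr !scale0r addr0.
- rewrite star_z2z2 star_z3z3 -sphere4 !scalerDr scalerA.
  rewrite (AC ((2*1)*(1*2)*1) ((2*3*5)*(1*6)*4*7)) /= -!scalerDl.
  have -> : q * q * (1 - q ^+ 2) + q ^+ 2 * q ^+ 2 + (1 - q ^+ 2) = 1 by ring.
  have -> : q * q + (1 - q ^+ 2) = 1 by ring.
  by rewrite !scale1r.
Qed.

Lemma star_S7a : (S7a q)^*s = z4 * z1^*s - z3 * z2^*s.
Proof. by rewrite sstarB !sstarM !sstarK. Qed.

Lemma star_S7b : (S7b q)^*s = z3^*s * z1^*s + q^-1 *: (z4^*s * z2^*s).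
Proof. by rewrite sstarD sstarZ !sstarM fmorphV /= q_real. Qed.

Lemma star_S7R : (S7R q)^*s = S7R q.
Proof. by rewrite sstarD !sstarM !sstarK. Qed.

Lemma bundleE : map_mx val (Gq q) = bundle *m bundle_star.
Proof.
apply/matrixP => i j; rewrite !mxE !big_ord_recr big_ord0 /= add0r !mxE.
case: i => -[|[|[|[|//]]]] ?; case: j => -[|[|[|[|//]]]] ? /=.
all: rewrite -?(scalerAl, scalerAr).
all: rewrite ?(mulrN, mulNr, scalerN, opprK, scalerA, mulr1, mul1r).
all: rewrite ?(star_S7a, star_S7b) /S7R /S7a /S7b.
all: rewrite ?(scalerBr, scalerDr, scalerA).
(* The sixteen entries follow, row by row. The zero entries are commutation relations; (2,2) and
   (3,3), counted from 0, use the sphere relation. *)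
- by [].
- rewrite [z1 * z2]sgenC // scalerA -scalerDl.
  by rewrite -expr2 -exprSr -exprS subrr scale0r.
- by [].
- by rewrite -expr2 expr2 mulfK.
- rewrite [z2^*s * z1^*s]sgen_starstarC // scalerA -scalerDl.
  by rewrite -expr2 subrr scale0r.
- rewrite star_z2z2 star_z1z1 scalerDr scalerA -addrA -scalerDl addrC.
  by congr (_ *: _ + _ *: _); ring.
- rewrite [z4^*s * z2^*s]sgen_starstarC // [z3^*s * z1^*s]sgen_starstarC //.
  by rewrite !scalerA mulfV // mul1r addrC scaleNr opprK expr2.
- rewrite [z2^*s * z3]sgen_starC // [z1^*s * z4]sgen_starC //.
  by rewrite !scalerA opprB mulNr scaleNr -expr2 -exprSr.
- by rewrite scaleNr.
- rewrite [z1 * z3]sgenC // [z2 * z4]sgenC //.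
  by rewrite !scalerA -expr2 mulfV // mul1r addrC.
- by rewrite -sphere4 -[s1 + s2 + s3 + s4]addrA [s1 + s2 + _]addrC addrK addrC.
- by rewrite [z3 * z4]sgenC // scalerA mulN1r scaleNr subrr.
- by rewrite expr2 mulfK.
- rewrite [z3^*s * z2]sgen_starC // [z4^*s * z1]sgen_starC //.
  by rewrite !scalerA opprB mulNr scaleNr -expr2 -exprSr.
- by rewrite [z4^*s * z3^*s]sgen_starstarC // scalerA mulN1r scaleNr subrr.
- apply/eqP; rewrite star_z3z3 star_z4z4 subr_eq -sphere4 !scalerDr !scalerA.
  rewrite (AC ((1*2)*(1*3)*2) ((2*5*8)*(3*6*9)*(1*7)*4)) /= -!scalerDl.
  have -> : q * q * (1 - q ^+ 2) + (1 - q ^+ 2) + q ^+ 4 = 1 by ring.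
  have -> : q * q + (1 - q ^+ 2) = 1 by ring.
  by rewrite !scale1r.
Qed.

(** The factor [bundle] has entries in [S7], so the computation takes place there and returns to
    [Sigma4] by injectivity of [val]. *)
Lemma Gq_idem : Gq q *m Gq q = Gq q.
Proof.
have valM : map_mx val (Gq q *m Gq q) = map_mx val (Gq q).
  rewrite map_mxM bundleE.
  by rewrite mulmxA -[X in X *m _]mulmxA bundle_isometry mulmx1.
apply/matrixP => i j; apply: val_inj.
by have /matrixP/(_ i j) := valM; rewrite !mxE.
Qed.

End ProjectionFactorization.

(** * Sums over N x N and the double geometric series *)

Section DiagonalTrace.
Import numFieldNormedType.Exports.
Variables (R : realType).
Local Open Scope complex_scope.
Local Open Scope classical_set_scope.

Lemma csum_cvg (f : nat * nat -> R[i]) (a b : R) :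
  (fun N => \sum_(i < N) \sum_(j < N) complex.Re (f (i : nat, j : nat)))
    @ \oo --> a ->
  (fun N => \sum_(i < N) \sum_(j < N) complex.Im (f (i : nat, j : nat)))
    @ \oo --> b ->
  csum f = a +i* b.
Proof. by move=> fa fb; congr (_ +i* _); apply: cvg_lim. Qed.

Lemma square_sum_delta (n : nat * nat) (f : nat * nat -> R) N :
  (forall m, m != n -> f m = 0) -> (n.1 < N)%N -> (n.2 < N)%N ->
  \sum_(i < N) \sum_(j < N) f (i : nat, j : nat) = f n.
Proof.
case: n => n1 n2 f0 /= n1N n2N; rewrite (bigD1 (Ordinal n1N)) //=.
rewrite (bigD1 (Ordinal n2N)) //= !big1 ?addr0 //.
- move=> i ni; rewrite big1 // => j _; rewrite f0 // xpair_eqE.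
  apply: contraNN ni => /andP[/eqP ni _]; exact/eqP/val_inj.
- move=> j jn; rewrite f0 // xpair_eqE eqxx /=.
  by apply: contraNN jn => /eqP jn; apply/eqP/val_inj.
Qed.

Lemma csum_delta (n : nat * nat) (f : nat * nat -> R[i]) :
  (forall m, m != n -> f m = 0) -> csum f = f n.
Proof.
move=> f0; rewrite (@csum_cvg f (complex.Re (f n)) (complex.Im (f n))).
- by case: (f n).
(* From this rank on the square contains [n], so the partial sums are constant. *)
- apply: cvg_near_cst; exists (n.1 + n.2).+1 => // N /= nN.
  apply: (@square_sum_delta n (fun m => complex.Re (f m))) => [m /f0 -> //||];
    by apply: leq_trans nN; rewrite ltnS ?leq_addr ?leq_addl.
- apply: cvg_near_cst; exists (n.1 + n.2).+1 => // N /= nN.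
  apply: (@square_sum_delta n (fun m => complex.Im (f m))) => [m /f0 -> //||];
    by apply: leq_trans nN; rewrite ltnS ?leq_addr ?leq_addl.
Qed.

Lemma ketZE c n m : (c *: ket R n) m = c * (m == n)%:R.
Proof. by []. Qed.

Lemma dot_ketl c n (v : ell2 R) : dot (c *: ket R n) v = c^* * v n.
Proof.
rewrite /dot (@csum_delta n) => [|m /negbTE mn]; rewrite ketZE.
  by rewrite eqxx mulr1.
by rewrite mn mulr0 rmorph0 mul0r.
Qed.

Lemma csum_real (f : nat * nat -> R) : csum (fun n => (f n)%:C) =
  (limn (fun N => \sum_(i < N) \sum_(j < N) f (i : nat, j : nat)))%:C.
Proof.
rewrite /csum /= (_ : (fun N => \sum_(i < N) \sum_(j < N) 0) = fun=> 0).
  by rewrite lim_cst.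
by apply/funext => N; rewrite big1 // => i _; rewrite big1.
Qed.

Lemma csum_real_ge0 (f : nat * nat -> R) :
  (forall n, 0 <= f n) -> 0 <= csum (fun n => (f n)%:C).
Proof.
move=> f0; rewrite csum_real lecR.
set u := fun N => _; have [cu|du] := pselect (cvgn u).
  apply: limr_ge => //; apply: nearW => N; apply: sumr_ge0 => i _.
  exact: sumr_ge0.
(* A divergent sequence has the default limit 0, which is still nonnegative. *)
by rewrite (dvgP du).
Qed.

Lemma sum_geometric (r : R) N :
  (1 - r) * \sum_(i < N) r ^+ i = 1 - r ^+ N.
Proof. by rewrite -opprB mulNr -subrX1 opprB. Qed.

Variables (q : R) (q_gt0 : 0 < q) (q_lt1 : q < 1).

(** The eigenvalues of (1 - q^2)^2 sigma(R); the prefactor normalizes their sum to 1. *)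
Definition geom2 (n : nat * nat) : R :=
  (1 - q ^+ 2) ^+ 2 * q ^+ (2 * (n.1 + n.2)).

Lemma geom2_ge0 n : 0 <= geom2 n.
Proof. by rewrite mulr_ge0 ?sqr_ge0 ?exprn_ge0 // ltW. Qed.

(** The sum over a square is the product of two equal finite geometric sums, each absorbing one
    factor 1 - q^2. *)
Lemma sum_geom2 N :
  \sum_(i < N) \sum_(j < N) geom2 (i : nat, j : nat) = (1 - q ^+ 2 ^+ N) ^+ 2.
Proof.
rewrite -sum_geometric exprMn [X in _ * X]expr2 big_distrlr mulr_sumr.
apply: eq_bigr => i _; rewrite mulr_sumr; apply: eq_bigr => j _.
by rewrite /geom2 mulnDr exprD !exprM.
Qed.

Lemma cvg_sum_geom2 :
  (fun N => \sum_(i < N) \sum_(j < N) geom2 (i : nat, j : nat))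
    @ \oo --> (1 : R).
Proof.
rewrite (_ : (fun N => _) = fun N => (1 - q ^+ 2 ^+ N) ^+ 2); last first.
  by apply/funext => N; exact: sum_geom2.
rewrite -[X in _ --> X](_ : (1 - 0) ^+ 2 = 1); last by rewrite subr0 expr1n.
have q2 : `|q ^+ 2| < 1.
  by rewrite ger0_norm ?exprn_ge0 ?expr_lt1 // ltW.
have cq : (fun N => 1 - q ^+ 2 ^+ N) @ \oo --> (1 - 0 : R).
  by apply: cvgB; [exact: cvg_cst|exact: cvg_expr].
by rewrite expr2; apply: cvgM.
Qed.

(** Any finite set of indices sits in a square, whose sum (1 - q^(2N))^2 is at most 1. *)
Lemma esum_geom2 : (\esum_(n in [set: nat * nat]) (geom2 n)%:E <= 1)%E.
Proof.
apply: ge_ereal_sup => _ [X [finX _] <-].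
pose N := (\max_(n <- finmap.enum_fset (fset_set X)) (n.1 + n.2)).+1.
have XN : X `<=` `I_N `*` `I_N.
  move=> n Xn; have nN : (n.1 + n.2 < N)%N.
    rewrite ltnS; apply: (@leq_bigmax_seq _ _ _ (fun n => n.1 + n.2)%N) => //.
    by rewrite in_fset_set ?inE.
  by split; apply: leq_ltn_trans nN; rewrite ?leq_addr ?leq_addl.
have finN : finite_set (`I_N `*` `I_N) by apply: finite_setX.
apply: (@le_trans _ _ (\sum_(n \in `I_N `*` `I_N) (geom2 n)%:E)%E).
  apply: lee_fsum_nneg_subset => // [n|n _]; first by rewrite !inE; apply: XN.
  by rewrite lee_fin geom2_ge0.
rewrite fsumEFin // lee_fin.
rewrite -(@pair_fsbig _ _ _ _ _ _ _ (fun i j => geom2 (i, j))) //.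
rewrite -fsbig_ord.
rewrite (eq_bigr (fun i : 'I_N => \sum_(j < N) geom2 (i : nat, j : nat))).
  have [q_ge0 q_le1] : 0 <= q /\ q <= 1 by split; apply: ltW.
  rewrite sum_geom2 expr_le1 ?subr_ge0 ?lerBlDr ?lerDl //;
    by rewrite ?exprn_ile1 ?exprn_ge0.
by move=> i _; rewrite -fsbig_ord.
Qed.

End DiagonalTrace.

Lemma conj_real_complex (R : realType) (a : R) : Num.conj (a%:C)%C = (a%:C)%C.
Proof. by apply/conj_Creal/complex_realP; exists a. Qed.

Lemma conj_mul_self (R : realType) (z : R[i]%C) :
  Num.conj z * z = (sqmod z)%:C%C.
Proof.
case: z => a b; apply/eqP; rewrite eq_complex /=.
by apply/andP; split; apply/eqP; rewrite /sqmod /=; ring.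
Qed.

(** * The pairing with the trace of the representation *)

Section SigmaTrace.
Variables (R : realType) (q : R) (q_gt0 : 0 < q) (q_lt1 : q < 1).
Local Open Scope complex_scope.
Local Open Scope classical_set_scope.
Local Notation Sigma := (Sigma4 q%:C).
Variables (eps : Sigma -> R[i]) (sigma : Sigma -> ell2 R -> ell2 R).
Hypotheses (epsP : is_epsilon eps) (sigmaP : is_sigma sigma).
Local Notation gR := (gR q%:C).

Lemma gR_star : Sigma4_star gR = gR.
Proof. by apply: val_inj; exact: star_S7R. Qed.

Lemma sigma_linear c x y u : sigma (c *: x + y) u = c *: sigma x u + sigma y u.
Proof. by case: sigmaP => -[]. Qed.

Lemma sigmaZ c x u : sigma (c *: x) u = c *: sigma x u.
Proof.
have s0 : sigma 0 u = 0.
  apply: (addrI (sigma 0 u)); rewrite -{1}[sigma 0 u]scale1r -sigma_linear.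
  by rewrite scaler0 !addr0.
by rewrite -[c *: x]addr0 sigma_linear s0 addr0.
Qed.

(** The action is prescribed on basis vectors only. Self-adjointness moves R onto [ket R n], where
    the inner product reads off coordinate [n] of any vector. *)
Lemma sigma_gR u n : sigma gR u n = (q ^+ (2 * (n.1 + n.2)))%:C * u n.
Proof.
case: sigmaP => -[_ _ _ _ sadj] sR _ _.
have := sadj gR (ket R n) u; rewrite gR_star {1}[n]surjective_pairing sR.
rewrite -surjective_pairing dot_ketl -{1}[ket R n]scale1r dot_ketl.
by rewrite rmorph1 mul1r => <-; rewrite conj_real_complex.
Qed.

(** Chosen so that Tr G = 2 - [x]. *)
Let x := ((1 - q ^+ 2) ^+ 2)%:C *: gR.

Lemma sigma_x u n : sigma x u n = (geom2 q n)%:C * u n.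
Proof.
by rewrite sigmaZ -[LHS]/(_ * sigma gR u n) sigma_gR mulrA -rmorphM.
Qed.

(** As eps(x) = 0, subtracting eps(Tr G) = 2 removes exactly the scalar part of sigma(Tr G). *)
Lemma tr_sigma_operator :
  (fun u => sigma (\tr (Gq q%:C)) u - eps (\tr (Gq q%:C)) *: u) = sigma (- x).
Proof.
(* This shape matches the form c x + y in which linearity of [eps] and [sigma] is given. *)
have trE : \tr (Gq q%:C) = -1 *: x + (1 *: 1 + 1).
  rewrite mxtrace_Gq scaleN1r scale1r addrC /x.
  by rewrite rmorphXn rmorphB rmorph1 rmorphXn.
case: epsP => -[epsL eps1 epsM _] epsR _ _.
case: sigmaP => -[_ _ sigma1 _ _] _ _ _.
have eps0 : eps 0 = 0.
  by apply: (addrI (eps 0)); rewrite -{1}[eps 0]mul1r -epsL scaler0 !addr0.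
have epsx : eps x = 0 by rewrite /x -[_ *: _]addr0 epsL epsR mulr0 eps0 addr0.
apply/funext => u; rewrite trE !sigma_linear !epsL epsx eps1 sigma1.
by rewrite mulr0 add0r mul1r !scale1r scalerDl scale1r addrK -sigmaZ scaleN1r.
Qed.

Lemma sigma_Nx u n : sigma (- x) u n = - sigma x u n.
Proof. by rewrite -scaleN1r sigmaZ scaleN1r. Qed.

Lemma sigma_x_positive : positive_operator (sigma x).
Proof.
split; first by case: sigmaP => -[].
move=> u; rewrite /dot.
rewrite (_ : (fun n => _) = fun n => (geom2 q n * sqmod (u n))%:C).
  by apply: csum_real_ge0 => n; rewrite mulr_ge0 ?sqmod_ge0 ?geom2_ge0.
apply/funext => n; rewrite sigma_x mulrCA [RHS]rmorphM; congr (_ * _).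
exact: conj_mul_self.
Qed.

Lemma dot_ket_sigma_x n : dot (ket R n) (sigma x (ket R n)) = (geom2 q n)%:C.
Proof.
rewrite -{1}[ket R n]scale1r dot_ketl rmorph1 mul1r sigma_x.
by rewrite -[ket R n n]/((n == n)%:R) eqxx mulr1.
Qed.

Lemma dot_ket_sigma_Nx n :
  dot (ket R n) (sigma (- x) (ket R n)) = (- geom2 q n)%:C.
Proof.
rewrite -{1}[ket R n]scale1r dot_ketl rmorph1 mul1r sigma_Nx sigma_x.
by rewrite -[ket R n n]/((n == n)%:R) eqxx mulr1 rmorphN.
Qed.

Lemma sigma_Nx_trace_class : trace_class (sigma (- x)).
Proof.
split; first by case: sigmaP => -[].
(* The absolute value of -sigma(x) is sigma(x), since the latter is positive and signs cancel in the
   inner products. *)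
exists (sigma x); split; first exact: sigma_x_positive.
- move=> u v; congr csum; apply/funext => n.
  by rewrite !sigma_Nx rmorphN mulrNN.
- rewrite (eq_esum (b := fun n => (geom2 q n)%:E)).
    by apply: le_lt_trans (esum_geom2 q_gt0 q_lt1) _; rewrite ltry.
  by move=> n _; rewrite dot_ket_sigma_x.
Qed.

Lemma tr_sigma_Gq : pairing0 (tr_sigma eps sigma) (Gq q%:C) = -1.
Proof.
rewrite /pairing0 /tr_sigma tr_sigma_operator /trace.
(* This excludes the default value 0 that [trace] takes outside the trace class. *)
case: asboolP => [_|[]]; last exact: sigma_Nx_trace_class.
rewrite (_ : (fun n => _) = fun n => (- geom2 q n)%:C); last first.
  by apply/funext => n; rewrite dot_ket_sigma_Nx.
have sumN : (fun N => \sum_(i < N) \sum_(j < N) - geom2 q (i : nat, j : nat)) =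
            - (fun N => \sum_(i < N) \sum_(j < N) geom2 q (i : nat, j : nat)).
  apply/funext => N; rewrite /GRing.opp /= -sumrN.
  by apply: eq_bigr => i _; rewrite -sumrN.
rewrite csum_real sumN (cvg_lim _ (cvgN (cvg_sum_geom2 q_gt0 q_lt1))) //.
by rewrite rmorphN1.
Qed.

End SigmaTrace.

Local Open Scope complex_scope.

Theorem proposition10 (R : realType) (q : R) (q_gt0 : 0 < q) (q_lt1 : q < 1) :
  (exists GG : Gq q%:C *m Gq q%:C = Gq q%:C,
     forall n : nat, ch_lambda GG n != 0) /\
  (forall (eps : Sigma4 q%:C -> R[i])
          (sigma : Sigma4 q%:C -> ell2 R -> ell2 R),
     is_epsilon eps -> is_sigma sigma ->
     pairing0 (tr_sigma eps sigma) (Gq q%:C) = -1).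
Proof.
split; last by move=> eps sigma epsP sigmaP; exact: tr_sigma_Gq.
have q_neq0 : q%:C != 0 by rewrite fmorph_eq0 gt_eqF.
exists (Gq_idem q_neq0 (conj_real_complex q)) => n.
(* One character detects the classes in all degrees n, its value on Tr G being 2. *)
apply: (ch_lambda_neq0 (@Sigma4_charZ _ _)).
by rewrite [X in X != 0]Sigma4_char_mxtrace pnatr_eq0.
Qed.
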